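(* Let $\mathscr{T}$ be a finite rooted tree with root $\rho$, set of leaves $\mathscr{L}$ and with $|\mathrm{ch}(\rho)|\ge 2$, let $\mathbf{V}=(V_\lambda)_{\lambda\in\mathscr{L}}$ with $V_\lambda=\mathbb{C}^{d_\lambda}$, and let $\mathbf{r}=(r_v)_{v\in\mathscr{T}\setminus\{\rho\}}$ be an admissible rank sequence. Let $\psi\in\bigotimes_{\lambda\in\mathscr{L}}V_\lambda$ be a tensor of indeterminates $\psi_{(j_\lambda)_{\lambda\in\mathscr{L}}}$ ($1\le j_\lambda\le d_\lambda$), and for $v\in\mathscr{T}\setminus\{\rho\}$ let $\psi^{(v)}$ be its flattening with respect to $\mathscr{L}(v)\mid\mathscr{L}\setminus\mathscr{L}(v)$. Then the homogeneous prime ideal of the tree tensor network variety $\mathrm{TTN}_{\mathscr{T},\mathbf{V},\mathbf{r}}$ in the polynomial ring $\mathbb{C}[\psi]$ is $$\mathcal{I}(\mathrm{TTN}_{\mathscr{T},\mathbf{V},\mathbf{r}})=\sum_{v\in\mathscr{T}\setminus\{\rho\}}\big\langle (r_v+1)\text{-minors of }\psi^{(v)}\big\rangle .$$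
   Context: Tree: $\mathscr{T}$ is a finite rooted tree with root $\rho$; we also write $\mathscr{T}$ for its vertex set. For a vertex $v$, $\mathrm{ch}(v)$ is the set of its children. Leaves $\mathscr{L}$ are the vertices without children; $\mathscr{N}=\mathscr{T}\setminus\mathscr{L}$ is the set of internal nodes, which contains $\rho$. Internal nodes may have any number $\geq 1$ of children, but $|\mathrm{ch}(\rho)|\ge2$. For a vertex $v$, $\mathscr{L}(v)$ is the set of leaves in the subtree rooted at $v$. Data: $V_\lambda=\mathbb{C}^{d_\lambda}$ with $d_\lambda$ a positive integer for $\lambda\in\mathscr{L}$; $W=\bigotimes_{\lambda\in\mathscr{L}}V_\lambda$. A rank sequence is a family $\mathbf{r}=(r_v)_{v\in\mathscr{T}\setminus\{\rho\}}$ of positive integers; put $r_\rho:=1$. It is admissible if $r_\lambda\le d_\lambda$ for every $\lambda\in\mathscr{L}$ and $r_v\le\prod_{u\in\mathrm{ch}(v)}r_u$ for every $v\in\mathscr{N}\setminus\{\rho\}$. Tree tensor network variety: $\mathrm{TTN}_{\mathscr{T},\mathbf{V},\mathbf{r}}\subset\mathbb{P}(W)$ is the set of $[\psi]\in\mathbb{P}(W)$ such that for each vertex $v\in\mathscr{T}$ there is a linear subspace $U_v$ with $\dim U_v\le r_v$ satisfying: $U_\lambda\subseteq V_\lambda$ for $\lambda\in\mathscr{L}$; $U_v\subseteq\bigotimes_{u\in\mathrm{ch}(v)}U_u$ for $v\in\mathscr{N}$; and some representative $\psi$ of $[\psi]$ lies in $U_\rho$. Flattening: $\psi^{(v)}$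 is the $\big(\prod_{\lambda\in\mathscr{L}(v)}d_\lambda\big)\times\big(\prod_{\lambda\in\mathscr{L}\setminus\mathscr{L}(v)}d_\lambda\big)$ matrix whose entry in row $(j_\lambda)_{\lambda\in\mathscr{L}(v)}$ and column $(j_\lambda)_{\lambda\in\mathscr{L}\setminus\mathscr{L}(v)}$ is $\psi_{(j_\lambda)_{\lambda\in\mathscr{L}}}$. $\mathcal{I}(X)$ denotes the ideal generated by all homogeneous polynomials in $\mathbb{C}[\psi]$ (polynomial ring in the entries of $\psi$) vanishing on $X\subseteq\mathbb{P}(W)$. *)

(* Defs.v *)
From HB Require Import structures.
From mathcomp Require Import all_boot all_order all_algebra.
From mathcomp Require Import boolp classical_sets reals.
From mathcomp Require Import complex.
From mathcomp Require Import mpoly.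

Set Implicit Arguments.
Unset Strict Implicit.
Unset Printing Implicit Defensive.

Import Order.TTheory GRing.Theory Num.Theory.

Local Open Scope ring_scope.

(* A finite rooted tree is encoded by its parent function, extended by        *)
(* sending the root to itself.                                                *)
Record rooted_tree := RootedTree {
  vertex :> finType;
  root_vertex : vertex;
  parent : vertex -> vertex;
  parent_root : parent root_vertex = root_vertex;
  reach_root : forall v, exists k, iter k parent v = root_vertex
}.

Section Tree.
Variable t : rooted_tree.

Definition children (v : t) : {set t} :=
  [set u | (u != root_vertex t) && (parent u == v)].

Definition leaves : {set t} := [set v | children v == finset.set0].

Definition leaves_below (v : t) : {set t} :=
  [set l in leaves | fconnect (@parent t) l v].

Lemma leaves_below_root : leaves_below (root_vertex t) = leaves.
Proof.
apply/setP=> l; rewrite !inE; case: (_ == _) => //=.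
by have [k <-] := reach_root l; rewrite fconnect_iter.
Qed.

Lemma leaves_below_leaf (l : t) : l \in leaves -> leaves_below l = [set l]%SET.
Proof.
rewrite inE => /eqP hl; apply/setP=> u; rewrite !inE.
apply/andP/eqP => [[_ /iter_findex] | ->]; last by rewrite hl eqxx connect0.
elim: (findex _ _ _) => [//|k IH] /= e.
have [c0|c0] := eqVneq (iter k (@parent t) u) (root_vertex t).
  by apply: IH; rewrite -e c0 parent_root.
by have := finset.in_set0 (iter k (@parent t) u); rewrite -hl inE c0 e eqxx.
Qed.

Lemma leaves_below_child (u v : t) :
  u \in children v -> leaves_below u \subset leaves_below v.
Proof.
rewrite inE => /andP[_ /eqP <-]; apply/fintype.subsetP=> l; rewrite !inE.
by case/andP=> -> h; rewrite (connect_trans h) ?fconnect1.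
Qed.

End Tree.

Section Ideals.
Variable A : comNzRingType.

Definition ideal_gen (S : set A) : set A :=
  [set p | exists n (a s : 'I_n -> A),
     (forall i, S (s i)) /\ p = \sum_(i < n) a i * s i]%classic.

Definition ideal_sum (I : finType) (P : pred I) (J : I -> set A) : set A :=
  [set p | exists q : I -> A,
     (forall i, P i -> J i (q i)) /\ p = \sum_(i | P i) q i]%classic.

Definition prime_ideal (J : set A) : Prop :=
  ~ J 1 /\ (forall p q, J (p * q) -> J p \/ J q).

Definition minors (k m n : nat) (M : 'M[A]_(m, n)) : set A :=
  [set p | exists (f : 'I_k -> 'I_m) (g : 'I_k -> 'I_n),
     [/\ {homo f : i j / (i < j)%N}, {homo g : i j / (i < j)%N}
       & p = \det (mxsub f g M)]]%classic.

End Ideals.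

Section MultiIndices.
Variables (T : finType) (d : T -> nat).
Implicit Types A B : {set T}.

Definition multi_index A : finType :=
  {dffun forall x : {x | x \in A}, 'I_(d (val x))}.

Definition restrict_index A B (sAB : A \subset B) (j : multi_index B) :
    multi_index A :=
  finfun (fun x : {x | x \in A} =>
    j (exist _ (val x) (fintype.subsetP sAB _ (valP x))) : 'I_(d (val x))).

(* The index agreeing with j on A and with k on B \ A.                        *)
Definition merge_index A B (j : multi_index A) (k : multi_index (B :\: A)) :
    multi_index B :=
  finfun (fun x : {x | x \in B} =>
    match boolP (val x \in A) return 'I_(d (val x)) with
    | AltTrue xA => j (exist _ (val x) xA)
    | AltFalse xA =>
        k (exist _ (val x) (introT finset.setDP (conj (valP x) xA)))
    end).

End MultiIndices.

(* The point [x] of P(V) is the line spanned by x.                            *)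
Definition proj_space (F : fieldType) (V : vectType F) : Type :=
  {l : {vspace V} | \dim l == 1%N}.

Definition represents (F : fieldType) (V : vectType F) (x : V)
    (l : proj_space V) : Prop :=
  x != 0 /\ x \in val l.

Section TreeTensorNetworks.
Variables (R : realType) (t : rooted_tree) (d r : t -> nat).

Local Notation C := R[i].

(* The tensor product of the C^(d l), l in A, in coordinates. For a leaf l,   *)
(* leaves_below l = [set l], so tensor (leaves_below l) is V_l = C^(d l).     *)
Definition tensor (A : {set t}) : vectType C :=
  {ffun multi_index d A -> C^o}.

Definition pure_tensor (v : t)
    (f : forall u : {u | u \in children v}, tensor (leaves_below (val u))) :
    tensor (leaves_below v) :=
  [ffun j => \prod_(u : {u | u \in children v})
     f u (restrict_index (leaves_below_child (valP u)) j)].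

(* The tensor product of the U u, u in ch(v), inside that of the spaces       *)
(* tensor (leaves_below u), which is tensor (leaves_below v).                 *)
Definition tensor_prod (U : forall u : t, {vspace tensor (leaves_below u)})
    (v : t) : set (tensor (leaves_below v)) :=
  [set x | exists n (c : 'I_n -> C)
     (f : 'I_n -> forall u : {u | u \in children v},
        tensor (leaves_below (val u))),
     (forall i u, f i u \in U (val u)) /\
     x = \sum_(i < n) c i *: pure_tensor (f i)]%classic.

Definition rank_sequence : Prop := forall v, v != root_vertex t -> (0 < r v)%N.

Definition admissible : Prop :=
  (forall l, l \in leaves t -> (r l <= d l)%N) /\
  (forall v, v \notin leaves t -> v != root_vertex t ->
     (r v <= \prod_(u in children v) r u)%N).

(* The convention that the root has rank 1; r (root_vertex t) is never used.  *)
Definition rank_at (v : t) : nat := if v == root_vertex t then 1%N else r v.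

(* leaves_below (root_vertex t) is the set of all leaves, by                  *)
(* leaves_below_root, so W is the tensor product of all the V_l.              *)
Local Notation W := (tensor (leaves_below (root_vertex t))).

Definition TTN : set (proj_space W) :=
  [set l | exists U : forall v : t, {vspace tensor (leaves_below v)},
     [/\ forall v, (\dim (U v) <= rank_at v)%N,
         forall v, v \notin leaves t ->
           forall x, x \in U v -> tensor_prod U x
       & exists x : W, represents x l /\ x \in U (root_vertex t)]]%classic.

Local Notation entry := (multi_index d (leaves_below (root_vertex t))).
Local Notation Cpsi := {mpoly C[#|{: entry}|]}.

Definition psi (j : entry) : Cpsi := 'X_(enum_rank j).

Definition poly_at (p : Cpsi) (x : W) : C := p.@[fun i => x (enum_val i)].

Definition vanishing_ideal (X : set (proj_space W)) : set Cpsi :=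
  ideal_gen [set p | (exists k : nat, p \is k.-homog) /\
    (forall l, X l -> forall x, represents x l -> poly_at p x = 0)]%classic.

Definition flattening (v : t) :
    'M[Cpsi]_(#|{: multi_index d (leaves_below v)}|,
      #|{: multi_index d (leaves_below (root_vertex t) :\: leaves_below v)}|) :=
  \matrix_(i, j) psi (merge_index (enum_val i) (enum_val j)).

End TreeTensorNetworks.

Arguments TTN R {t} d r.

(* Main.v *)
Require Import Defs.
From mathcomp Require Import all_boot all_order all_fingroup all_algebra.
From mathcomp Require Import boolp classical_sets reals.
From mathcomp Require Import complex.
From mathcomp Require Import mpoly.

(* In degree [n], polynomials in the entries of [psi] are spanned by monomials
   [prod_i psi (J i)], on which the groups 'S_n attached to the leaves act.  For a
   vertex [v], letting 'S_n act diagonally on the leaves below [v], an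
   antisymmetrizer on [r v + 1] positions turns a monomial into a minor of the
   flattening at [v] times a monomial.  In the group algebra of 'S_n the identity
   is, up to such antisymmetrizers, a combination of the matrix coefficients of
   the words in [r v] colours.  Applying this at all vertices, a polynomial
   [sum_J F J prod_i psi (J i)] is congruent modulo the minors to one whose
   coefficients are linear combinations of the coefficients of its pull-back
   along the parametrization of the tree tensor networks by tensors placed at
   the vertices.  So the kernel of this pull-back is contained
   in the ideal of minors; it is also the vanishing ideal, hence prime. *)

Set Implicit Arguments.
Unset Strict Implicit.
Unset Printing Implicit Defensive.

Import Order.TTheory GRing.Theory Num.Theory.

Local Open Scope ring_scope.

(** * Antisymmetrizers in the group algebra of 'S_n *)

(** Straightening at nested vertices composes permutations that need not commute: a leaf [l]
    receives the product of those chosen along its path to the root. The substitution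
    [S v = G v * (G (parent v))^-1] makes this product telescope to [G l], and the weight at [v]
    then involves only the two ends of the edge above [v]. After inverting [G], a matrix coefficient
    [[x o s = y]] at this edge says that the colours [x], read at copies of the parent tensor, and
    [y], read at copies of the tensor at [v], agree across the edge. Summing over [G] thus runs over
    the ways to glue [n] copies of every vertex tensor into [n] networks, and this is what a
    coefficient of the pull-back records, up to the stabilizer of its monomial. *)

Section ExtendPerm.
Variables (n k : nat) (h : 'I_k -> 'I_n) (h_inj : injective h).

Definition extend_fun (p : 'S_k) (i : 'I_n) : 'I_n :=
  if [pick a | h a == i] is Some a then h (p a) else i.

Lemma extend_fun_in p a : extend_fun p (h a) = h (p a).
Proof.
rewrite /extend_fun; case: pickP => [b /eqP/h_inj -> //|/(_ a)].
by rewrite eqxx.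
Qed.

Lemma extend_fun_out p i : (forall a, h a != i) -> extend_fun p i = i.
Proof.
move=> hi; rewrite /extend_fun; case: pickP => // a ha.
by move: (hi a); rewrite ha.
Qed.

Lemma extend_fun_inj p : injective (extend_fun p).
Proof.
apply: (@can_inj _ _ _ (extend_fun p^-1)%g) => i.
have [/existsP[a /eqP <-]|] := boolP [exists a, h a == i].
  by rewrite !extend_fun_in permK.
by rewrite negb_exists => /forallP hi; rewrite !extend_fun_out.
Qed.

Definition extend_perm p : 'S_n := perm (@extend_fun_inj p).

Lemma extend_perm_in p a : extend_perm p (h a) = h (p a).
Proof. by rewrite permE extend_fun_in. Qed.

Lemma extend_perm_out p i : (forall a, h a != i) -> extend_perm p i = i.
Proof. by move=> hi; rewrite permE extend_fun_out. Qed.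

Lemma extend_perm1 : extend_perm 1 = 1%g.
Proof.
apply/permP=> i; rewrite perm1.
have [/existsP[a /eqP <-]|] := boolP [exists a, h a == i].
  by rewrite extend_perm_in perm1.
by rewrite negb_exists => /forallP hi; rewrite extend_perm_out.
Qed.

End ExtendPerm.

(** * Lexicographic order and decreasing subsequences of permutations *)

Section PermutationOrder.
Variable n : nat.
Implicit Types s u : 'S_n.

Definition lex_word s : n.-tuplelexi 'I_n := [tuple s i | i < n].

Lemma lex_wordP s u : reflect
  (exists2 i : 'I_n, (forall j : 'I_n, (j < i)%N -> s j = u j) & (s i < u i)%N)
  (lex_word s < lex_word u)%O.
Proof.
apply: (iffP ltxi_tuplePlt) => -[i hj hi]; exists i.
- by move=> j /hj; rewrite !tnth_mktuple.
- by move: hi; rewrite !tnth_mktuple.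
- by move=> j /hj; rewrite !tnth_mktuple.
- by rewrite !tnth_mktuple.
Qed.

Lemma lex_word_inj : injective lex_word.
Proof.
move=> s u e; apply/permP => i.
by have := congr1 (fun w : n.-tuplelexi 'I_n => tnth w i) e; rewrite !tnth_mktuple.
Qed.

(** A numerical form of the lexicographic order, for induction on the leading permutation. *)
Definition lex_rank s := #|[set u : 'S_n | (lex_word u < lex_word s)%O]|.

Lemma lex_rank_lt s u : (lex_word s < lex_word u)%O -> (lex_rank s < lex_rank u)%N.
Proof.
move=> lt; apply: proper_card; apply/properP; split.
  by apply/fintype.subsetP => v; rewrite !inE => /lt_trans; apply.
by exists s; rewrite !inE ?lt // ltxx.
Qed.

Lemma lex_rank_inj s u : lex_rank s = lex_rank u -> s = u.
Proof.
move=> e; have [/lex_rank_lt|/lex_rank_lt|/lex_word_inj //] :=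
  ltgtP (lex_word s) (lex_word u); by rewrite e ltnn.
Qed.

Lemma lex_rankP s u : (lex_rank s < lex_rank u)%N = (lex_word s < lex_word u)%O.
Proof.
apply/idP/idP; last exact: lex_rank_lt.
by have [//|/lex_rank_lt|/lex_word_inj ->] := ltgtP (lex_word s) (lex_word u);
  rewrite ?ltnn // => /ltnW; rewrite leqNgt => /negbTE ->.
Qed.

(** The points before the first moved one are fixed, so by injectivity its image is not among
    them. *)
Lemma perm_first_moved (p : 'S_n) : p != 1%g ->
  exists2 i : 'I_n, (forall j : 'I_n, (j < i)%N -> p j = j) & (i < p i)%N.
Proof.
move=> p1; have [i0 hi0] : exists i, p i != i.
  apply/existsP; apply: contraR p1; rewrite negb_exists => /forallP h.
  by apply/eqP/permP => i; rewrite perm1; apply/eqP; move: (h i); rewrite negbK.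
have [i hi mi] := @arg_minnP _ i0 (fun i => p i != i) (fun i : 'I_n => i : nat) hi0.
have fixed (j : 'I_n) : (j < i)%N -> p j = j.
  by move=> lt; apply/eqP; apply: contraLR lt => /mi; rewrite -leqNgt.
exists i => //; rewrite ltnNge leq_eqVlt; apply/negP => /orP[/eqP/val_inj e|lt].
  by move: hi; rewrite e eqxx.
by have /perm_inj e := fixed _ lt; rewrite e ltnn in lt.
Qed.

Definition decreasing_on s (S : {set 'I_n}) : bool :=
  [forall i in S, forall j in S, (i < j)%N ==> (s j < s i)%N].

Lemma decreasing_onP s (S : {set 'I_n}) : reflect
  (forall i j : 'I_n, i \in S -> j \in S -> (i < j)%N -> (s j < s i)%N)
  (decreasing_on s S).
Proof.
apply: (iffP forall_inP) => [h i j iS jS lt|h i iS].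
  by move/forall_inP/(_ j jS)/implyP: (h i iS); apply.
by apply/forall_inP => j jS; apply/implyP => /h; apply.
Qed.

Definition ends_at s (i : 'I_n) (S : {set 'I_n}) :=
  [&& decreasing_on s S, i \in S & [forall j in S, (j <= i)%N]].

(** Length of the longest decreasing subsequence ending at position [i], the labelling of the
    Erdos-Szekeres argument. *)
Definition decreasing_depth s i := \max_(S | ends_at s i S) #|S|.

Lemma decreasing_depth_gt0 s i : (0 < decreasing_depth s i)%N.
Proof.
rewrite -(cards1 i); apply: (@leq_bigmax_cond _ _ (fun S : {set 'I_n} => #|S|)).
apply/and3P; split; rewrite ?inE //.
  by apply/decreasing_onP => a b /set1P -> /set1P ->; rewrite ltnn.
by apply/forall_inP => j /set1P ->.
Qed.

Lemma decreasing_depth_attained s i :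
  exists2 S, ends_at s i S & decreasing_depth s i = #|S|.
Proof.
have : (0 < #|[pred S | ends_at s i S]|)%N.
  apply/card_gt0P; exists [set i]; apply/and3P; split; rewrite ?inE //.
    by apply/decreasing_onP => a b /set1P -> /set1P ->; rewrite ltnn.
  by apply/forall_inP => k /set1P ->.
case/(eq_bigmax_cond (fun S : {set 'I_n} => #|S|)) => S eS e; exists S => //.
Qed.

(** Appending [j] prolongs an optimal decreasing subsequence ending at [i]. *)
Lemma decreasing_depth_lt s (i j : 'I_n) :
  (i < j)%N -> (s j < s i)%N -> (decreasing_depth s i < decreasing_depth s j)%N.
Proof.
move=> ij sij.
have [S /and3P[dS iS /forall_inP mS] ->] := decreasing_depth_attained s i.
have jS : j \notin S by apply/negP => /mS; rewrite leqNgt ij.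
have -> : (#|S|.+1 = #|j |: S|)%N by rewrite cardsU1 jS.
apply: (@leq_bigmax_cond _ _ (fun S : {set 'I_n} => #|S|)).
apply/and3P; split; first last.
- by apply/forall_inP => k /setU1P[->//|/mS ki]; apply: leq_trans ki (ltnW ij).
- by rewrite !inE eqxx.
move/decreasing_onP: dS => dS.
apply/decreasing_onP => a b /setU1P[->|aS] /setU1P[->|bS].
- by rewrite ltnn.
- by move=> lt; have := leq_trans lt (mS _ bS); rewrite leqNgt (ltnW _) // ltnS ltnW.
- move=> _; have [->//|ne] := eqVneq a i.
  apply: (ltn_trans sij); apply: dS => //.
  by rewrite ltn_neqAle mS // andbT.
- exact: dS.
Qed.

End PermutationOrder.
(** As [B] is fixed by conjugation, its row space is orthogonal to [kermx B^T] for the Hermitian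
    form; the two meet in 0 and their dimensions add up to [n]. *)
Lemma row_full_adds_ker_tr (C : numClosedFieldType) m n (B : 'M[C]_(m, n)) :
  map_mx Num.conj B = B -> row_full (B + kermx B^T)%MS.
Proof.
move=> Breal.
have cap0 : (B :&: kermx B^T = 0 :> 'M_n)%MS.
  apply/eqP; rewrite -submx0; apply/rV_subP => v.
  rewrite sub_capmx => /andP[/submxP[y vE] /sub_kermxP vB]; rewrite submx0.
  have vv : \sum_j `|v 0 j| ^+ 2 = 0.
    have : (v *m (map_mx Num.conj v)^T) 0 0 = 0.
      by rewrite {2}vE map_mxM Breal trmx_mul mulmxA vB mul0mx mxE.
    rewrite mxE => e; rewrite -[RHS]e; apply: eq_bigr => j _.
    by rewrite !mxE normCK.
  apply/eqP/rowP => j; rewrite mxE; apply/eqP; rewrite -normr_eq0 -sqrf_eq0.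
  by move: vv => /psumr_eq0P -> // k _; rewrite exprn_ge0.
rewrite /row_full -(eqn_add2r (\rank (B :&: kermx B^T)%MS)) mxrank_sum_cap cap0.
by rewrite mxrank0 addn0 mxrank_ker mxrank_tr subnKC // rank_leq_col.
Qed.

(** * Permutations acting on words in [r] colours *)

Section SchurWeylKernel.
Variables (C : numClosedFieldType) (n N r : nat).
Hypothesis r_le : (r <= N)%N.

Local Notation word := {ffun 'I_n -> 'I_N}.
Implicit Types (x y : word) (s : 'S_n).

Definition colours_below x : bool := [forall i, (x i < r)%N].

Definition word_perm x s : word := [ffun i => x (s i)].

(* Coefficient at [s] of the antisymmetrizer on the positions [h 0, ..., h r],
   followed by [u]. *)
Definition antisymmetrizer (h : 'I_r.+1 -> 'I_n) (h_inj : injective h) (u s : 'S_n) : C :=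
  \sum_(p : 'S_r.+1) (-1) ^+ p * (s == (extend_perm h_inj p * u)%g)%:R.

(** By the pigeonhole principle two of the [r + 1] positions carry the same colour; composing with
    their transposition pairs terms of opposite sign. *)
Lemma antisymmetrizer_kills h (h_inj : injective h) u x y : colours_below x ->
  \sum_s antisymmetrizer h_inj u s * (word_perm x s == y)%:R = 0.
Proof.
move=> /forallP vx.
have -> : \sum_s antisymmetrizer h_inj u s * (word_perm x s == y)%:R =
    \sum_(p : 'S_r.+1) (-1) ^+ p * (word_perm x (extend_perm h_inj p * u)%g == y)%:R.
  under eq_bigr do rewrite mulr_suml.
  rewrite exchange_big /=; apply: eq_bigr => p _.
  rewrite (bigD1 (extend_perm h_inj p * u)%g) //= eqxx mulr1 big1 ?addr0 // => s.
  by move/negbTE->; rewrite mulr0 mul0r.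
have [a [b [ab xab]]] : exists a b : 'I_r.+1, a != b /\ x (u (h a)) = x (u (h b)).
  have ninj : ~ injective (fun a : 'I_r.+1 => Ordinal (vx (u (h a)))).
    by move=> /leq_card; rewrite !card_ord ltnn.
  apply: contrapT => H; apply: ninj => a b /(congr1 val) /= e.
  apply/eqP; apply: contrapT => /negP ne; apply: H; exists a, b; split => //.
  exact: val_inj.
set S := \sum_p _.
have S_opp : S = - S.
  rewrite {1}/S (reindex_inj (mulIg (tperm a b))) /= /S -sumrN.
  apply: eq_bigr => p _; rewrite odd_permM odd_tperm ab addbT signrN mulNr.
  congr (- (_ * (_ == y)%:R)); apply/ffunP => i; rewrite !ffunE !permM.
  have [/existsP[c /eqP <-]|] := boolP [exists c, h c == i].
    rewrite !extend_perm_in permM; case: tpermP => [->|->|//] //.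
  by rewrite negb_exists => /forallP hi; rewrite !extend_perm_out.
by apply/eqP; move/eqP: S_opp; rewrite -addr_eq0 -mulr2n mulrn_eq0.
Qed.

(* Second fundamental theorem for the symmetric group: the annihilator of the
   words in [r] colours is spanned by antisymmetrizers.  The lexicographically
   largest permutation in the support either has a decreasing subsequence of
   length [r + 1], and is removed by an antisymmetrizer, or is detected by the
   word colouring each position with its decreasing depth. *)
Lemma annihilator_ind (P : ('S_n -> C) -> Prop) :
    (forall a b, a =1 b -> P a -> P b) ->
    P (fun _ => 0) ->
    (forall a c h (h_inj : injective h) u,
       P a -> P (fun s => a s + c * antisymmetrizer h_inj u s)) ->
  forall a : 'S_n -> C,
    (forall x y, colours_below x -> colours_below y ->
       \sum_s a s * (word_perm x s == y)%:R = 0) ->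
  P a.
Proof.
move=> Pext P0 Pstep a.
have [m] : exists m, forall s, a s != 0 -> (lex_rank s < m)%N.
  by exists #|{: 'S_n}|.+1 => s _; rewrite ltnS max_card.
elim: m a => [|m IH] a am ka.
  apply: Pext P0 => s; apply/eqP; rewrite eq_sym; apply/negPn/negP => /am.
  by rewrite ltn0.
have [/existsP[u /andP[au /eqP um]]|] :=
    boolP [exists u, (a u != 0) && (lex_rank u == m)]; last first.
  rewrite negb_exists => /forallP H; apply: IH ka => s as0.
  move: (am _ as0) (H s); rewrite as0 /= ltnS leq_eqVlt.
  by case/orP=> [->|].
have above s : (lex_word u < lex_word s)%O -> a s = 0.
  rewrite -lex_rankP um => lt; apply/eqP/negPn/negP => /am.
  by rewrite ltnS leqNgt lt.
have [good|] := boolP [forall i, (decreasing_depth u i <= r)%N].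
  (* Depths start at 1 and colours at 0, hence the predecessor. *)
  have cN i : ((decreasing_depth u i).-1 < N)%N.
    apply: leq_trans r_le; rewrite prednK ?decreasing_depth_gt0 //.
    exact: (forallP good).
  pose y : word := [ffun i => Ordinal (cN i)].
  pose x : word := [ffun i => y (u^-1 i)%g].
  have vy : colours_below y.
    apply/forallP => i; rewrite ffunE /= prednK ?decreasing_depth_gt0 //.
    exact: (forallP good).
  have vx : colours_below x by apply/forallP => i; rewrite ffunE; apply: (forallP vy).
  have := ka x y vx vy; rewrite (bigD1 u) //=.
  have -> : word_perm x u = y by apply/ffunP => i; rewrite !ffunE permK.
  rewrite eqxx mulr1 big1 ?addr0; first by move=> a0; rewrite a0 eqxx in au.
  (* If [s] also carries [x] to [y], then [s * u^-1] preserves depth. At its first moved point [i]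
     this forces [u i < s i], so [s] lies above the leading permutation [u]. *)
  move=> s su; have [/eqP/ffunP e|_] := boolP (_ == y); last by rewrite mulr0.
  rewrite above ?mul0r //.
  have [|i fixed lt] := @perm_first_moved _ (s * u^-1)%g.
    by apply: contraNneq su => e1; rewrite -(mulgKV u s) e1 mul1g.
  apply/lex_wordP; exists i => [j /fixed ji|].
    by rewrite -{1}ji permM permKV.
  have /(congr1 val) := e i; rewrite !ffunE /=.
  rewrite permM in lt; set q := (u^-1 (s i))%g in lt * => /(congr1 S).
  rewrite !prednK ?decreasing_depth_gt0 // => eqd.
  have -> : s i = u q by rewrite permKV.
  rewrite ltnNge leq_eqVlt; apply/negP => /orP[/eqP/val_inj/perm_inj e1|lt1].
    by rewrite e1 ltnn in lt.
  by have := decreasing_depth_lt lt lt1; rewrite eqd ltnn.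
rewrite negb_forall => /existsP[l]; rewrite -ltnNge => deep.
have [S /and3P[dS _ _] eS] := decreasing_depth_attained u l.
rewrite eS in deep.
have [i0 i0S] : exists i0, i0 \in S by apply/card_gt0P; apply: leq_trans deep.
pose h (k : 'I_r.+1) : 'I_n := nth i0 (enum S) k.
have hS k : h k \in S.
  by rewrite /h -mem_enum mem_nth // -cardE (leq_trans (ltn_ord k)).
have h_inj : injective h.
  move=> k k' /eqP; rewrite /h nth_uniq ?enum_uniq -?cardE ?(leq_trans (ltn_ord _)) //.
  by move/eqP/val_inj.
apply: (Pext (fun s => (a s - a u * antisymmetrizer h_inj u s) +
                       a u * antisymmetrizer h_inj u s)).
  by move=> s; rewrite subrK.
apply: Pstep; apply: IH => [s|x y vx vy]; last first.
  under eq_bigr do rewrite mulrBl -mulrA.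
  by rewrite sumrB ka // -mulr_sumr antisymmetrizer_kills // mulr0 subr0.
(* [u] is the leading term of its antisymmetrizer: the first moved position goes to a later one of
   [S], where [u] is smaller. *)
have anti s' : antisymmetrizer h_inj u s' != 0 -> s' != u -> (lex_word s' < lex_word u)%O.
  move=> nz su.
  have [p /eqP es] : exists p, s' == (extend_perm h_inj p * u)%g.
    apply/existsP; apply: contraR nz; rewrite negb_exists => /forallP H.
    by rewrite /antisymmetrizer big1 // => p _; rewrite (negbTE (H p)) mulr0.
  have [|j fixed lt] := @perm_first_moved _ (extend_perm h_inj p).
    by apply: contraNneq su => e1; rewrite es e1 mul1g.
  apply/lex_wordP; exists j => [k /fixed kj|]; first by rewrite es permM kj.
  rewrite es permM.
  have [c /eqP hc] : exists c, h c == j.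
    apply/existsP; apply: contraTT lt; rewrite negb_exists => /forallP H.
    by rewrite extend_perm_out // ltnn.
  move: lt; rewrite -hc extend_perm_in => lt.
  by move/decreasing_onP: dS; apply.
have anti_u : antisymmetrizer h_inj u u = 1.
  rewrite /antisymmetrizer (bigD1 1%g) //= extend_perm1 mul1g eqxx odd_perm1 mulr1.
  rewrite big1 ?addr0 // => p p1; case: eqP => [e|_]; last by rewrite mulr0.
  case/negP: p1; apply/eqP/permP => c; rewrite perm1; apply/h_inj.
  rewrite -extend_perm_in; move/permP/(_ (h c)): e.
  by rewrite permM => /perm_inj/esym.
move=> nz; rewrite -um lex_rankP; move: nz.
have [->|su] := eqVneq s u; first by rewrite anti_u mulr1 subrr eqxx.
have [/anti -> //|] := boolP (antisymmetrizer h_inj u s != 0).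
rewrite negbK => /eqP ->; rewrite mulr0 subr0 => /am.
rewrite ltnS -um leq_eqVlt => /orP[/eqP/lex_rank_inj e|]; last by rewrite lex_rankP.
by rewrite e eqxx in su.
Qed.

(* The identity of the group algebra, up to antisymmetrizers, is a combination
   of matrix coefficients [s |-> [x o s = y]] of the words in [r] colours: these
   span the orthogonal complement of the annihilator. *)
Lemma identity_mod_antisymmetrizers : exists c : word -> word -> C,
  (forall x y, c x y != 0 -> colours_below x && colours_below y) /\
  forall P : ('S_n -> C) -> Prop,
    (forall a b, a =1 b -> P a -> P b) ->
    P (fun _ => 0) ->
    (forall a c h (h_inj : injective h) u,
       P a -> P (fun s => a s + c * antisymmetrizer h_inj u s)) ->
  P (fun s => (s == 1%g)%:R - \sum_x \sum_y c x y * (word_perm x s == y)%:R).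
Proof.
pose W := (word * word)%type.
pose val2 (i : 'I_#|{: W}|) : W := enum_val i.
pose ok (w : W) := colours_below w.1 && colours_below w.2.
pose B : 'M[C]_(#|{: W}|, #|{: 'S_n}|) := \matrix_(i, j)
  (ok (val2 i) && (word_perm (val2 i).1 (enum_val j) == (val2 i).2))%:R.
have Breal : map_mx Num.conj B = B by apply/matrixP => i j; rewrite !mxE conjC_nat.
pose e : 'rV[C]_(#|{: 'S_n}|) := \row_j (enum_val j == 1%g)%:R.
(* The indicator of the identity splits into a combination of the rows of [B], which are the matrix
   coefficients, and a vector orthogonal to them, which annihilates the words. *)
have /sub_addsmxP := submx_full e (row_full_adds_ker_tr Breal).
case=> -[u1 u2] /= eE.
pose k := u2 *m kermx B^T.
have kB : k *m B^T = 0 by rewrite -mulmxA mulmx_ker mulmx0.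
exists (fun x y => u1 0 (enum_rank (x, y)) * (ok (x, y))%:R); split.
  by move=> x y; apply: contraNT => /negbTE; rewrite /ok => ->; rewrite mulr0.
move=> P Pext P0 Pstep.
apply: (Pext (fun s => k 0 (enum_rank s))) => [s|].
  move/rowP/(_ (enum_rank s)): eE; rewrite mxE enum_rankK [RHS]mxE -/k => ->.
  apply/eqP; rewrite eq_sym subr_eq addrC (inj_eq (addrI _)); apply/eqP.
  rewrite mxE pair_bigA /= (reindex (enum_rank : W -> _)) /=; last first.
    by exists val2 => i _; rewrite /val2 ?enum_valK ?enum_rankK.
  apply: eq_bigr => -[x y] _; rewrite mxE /val2 enum_rankK enum_rankK /=.
  by rewrite -mulrA -natrM mulnb.
apply: annihilator_ind => // x y vx vy.
move/rowP/(_ (enum_rank (x, y))): kB; rewrite !mxE => kB.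
rewrite -[RHS]kB (reindex (enum_rank : 'S_n -> _)) /=; last first.
  by exists enum_val => i _; rewrite ?enum_valK ?enum_rankK.
by apply: eq_bigr => s _; rewrite !mxE /val2 !enum_rankK /ok vx vy.
Qed.

End SchurWeylKernel.

(** * Coefficients of vanishing polynomials *)

Section VanishingPolynomials.
Variable C : numDomainType.

Lemma poly_eq0_of_horner (p : {poly C}) : (forall z, p.[z] = 0) -> p = 0.
Proof.
move=> p0; apply/eqP/negPn/negP => pn0.
have := max_poly_roots (rs := [seq i%:R | i <- iota 0 (size p)]) pn0.
rewrite size_map size_iota ltnn => H; suff: false by []; apply: H.
  by apply/allP => _ /mapP[i _ ->]; apply/rootP.
by rewrite map_inj_uniq ?iota_uniq // => i j /eqP; rewrite eqr_nat => /eqP.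
Qed.

(** Monomials may be repeated in the list, so expanded products can be used without collecting
    terms. *)
Lemma coef_sum_eq0 (K : finType) (T : Type) (l : seq T) (c : T -> C)
    (e : T -> K -> nat) :
    (forall P : K -> C, \sum_(i <- l) c i * \prod_a P a ^+ e i a = 0) ->
  forall e0 : K -> nat, \sum_(i <- l | [forall a, e i a == e0 a]) c i = 0.
Proof.
move=> vanish e0.
(* The variables in [s] have already had their exponent extracted, one at a time, as a coefficient
   of a univariate polynomial. *)
have step (s : seq K) : uniq s -> forall P : K -> C,
    \sum_(i <- l | all (fun a => e i a == e0 a) s)
      c i * \prod_(a | a \notin s) P a ^+ e i a = 0.
  elim: s => [|b s IH] /= => [_ P|/andP[bs us] P].
    by rewrite -[RHS](vanish P); apply: eq_bigr.
  pose p : {poly C} := \sum_(i <- l | all (fun a => e i a == e0 a) s)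
    (c i * \prod_(a | a \notin b :: s) P a ^+ e i a) *: 'X^(e i b).
  have p0 : p = 0.
    apply: poly_eq0_of_horner => z.
    rewrite -(IH us (fun a => if a == b then z else P a)) horner_sum.
    apply: eq_bigr => i _; rewrite hornerZ hornerXn -mulrA; congr (_ * _).
    rewrite [RHS](bigD1 b) //= eqxx mulrC; congr (_ * _).
    apply: eq_big => [a|a]; first by rewrite inE negb_or andbC.
    by rewrite inE negb_or => /andP[/negbTE ->].
  rewrite -[RHS](coef0 _ (e0 b)) -p0 coef_sum big_mkcondl /=.
  by apply: eq_bigr => i _; rewrite coefZ coefXn eq_sym; case: eqP => _;
    rewrite ?mulr1 ?mulr0.
rewrite -[RHS](step (enum K) (enum_uniq _) (fun _ => 0)).
apply: eq_big => [i|i _].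
  by apply/forallP/allP => [h a _|h a]; [apply: h | apply: h; rewrite mem_enum].
by rewrite big_pred0 ?mulr1 // => a; rewrite mem_enum.
Qed.

End VanishingPolynomials.

(** * The order of a rooted tree *)

Section TreeOrder.
Variable t : rooted_tree.
Local Notation root := (root_vertex t).
Implicit Types u v w : t.

Definition below w v : bool := fconnect (@parent t) w v.

Lemma reach_root_bool v : exists k, iter k (@parent t) v == root.
Proof. by have [k /eqP] := reach_root v; exists k. Qed.

Definition depth v := ex_minn (reach_root_bool v).

Lemma iter_depth v : iter (depth v) (@parent t) v = root.
Proof. by rewrite /depth; case: ex_minnP => k /eqP. Qed.

Lemma depth_le v k : iter k (@parent t) v = root -> (depth v <= k)%N.
Proof. by rewrite /depth; case: ex_minnP => j _ min /eqP /min. Qed.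

Lemma depth_root : depth root = 0%N.
Proof. by apply/eqP; rewrite -leqn0; apply: depth_le. Qed.

Lemma depth_eq0 v : (depth v == 0%N) = (v == root).
Proof.
apply/eqP/eqP => [d0|->]; last exact: depth_root.
by rewrite -(iter_depth v) d0.
Qed.

Lemma depth_parent v : v != root -> depth v = (depth (parent v)).+1.
Proof.
move=> nr; apply/eqP; rewrite eqn_leq; apply/andP; split.
  by apply: depth_le; rewrite iterSr iter_depth.
move: (iter_depth v); have := depth_eq0 v; rewrite (negbTE nr).
by case: (depth v) => // k _; rewrite iterSr ltnS => /depth_le.
Qed.

Lemma depth_iter k v : depth (iter k (@parent t) v) = (depth v - k)%N.
Proof.
elim: k => [|k IH]; first by rewrite subn0.
rewrite iterS subnS -IH; set u := iter k _ v.
have [->|nr] := eqVneq u root; first by rewrite parent_root depth_root.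
by rewrite (depth_parent nr).
Qed.

Lemma belowP w v :
  reflect (exists2 k, (k <= depth w)%N & v = iter k (@parent t) w) (below w v).
Proof.
apply: (iffP idP) => [/iter_findex <-|[k _ ->]]; last exact: fconnect_iter.
set k := findex _ _ _; have [le|/ltnW lt] := leqP k (depth w); first by exists k.
exists (depth w) => //; rewrite iter_depth -(subnK lt) iterD iter_depth.
by elim: (_ - _)%N => //= j ->; rewrite parent_root.
Qed.

Lemma below_refl v : below v v. Proof. exact: connect0. Qed.

Lemma below_root v : below v root.
Proof. by have [k <-] := reach_root v; apply: fconnect_iter. Qed.

Lemma below_parent v : below v (parent v). Proof. exact: fconnect1. Qed.

Lemma below_trans : transitive below.
Proof. by move=> v u w; apply: connect_trans. Qed.

Lemma below_depth w v : below w v -> (depth v <= depth w)%N.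
Proof. by case/belowP => k _ ->; rewrite depth_iter leq_subr. Qed.

Lemma below_depth_inj w u v : below w u -> below w v -> depth u = depth v -> u = v.
Proof.
move=> /belowP[j lej ->] /belowP[k lek ->]; rewrite !depth_iter => e.
suff -> : j = k by [].
by rewrite -(subKn lej) e subKn.
Qed.

Lemma childrenP u v : reflect (u != root /\ parent u = v) (u \in children v).
Proof. by rewrite inE; apply: (iffP andP) => -[? /eqP]. Qed.

Lemma depth_child u v : u \in children v -> depth u = (depth v).+1.
Proof. by move=> /childrenP[nr <-]; apply: depth_parent. Qed.

Lemma below_child u v w : u \in children v -> below w u -> below w v.
Proof.
by move=> /childrenP[_ <-] wu; apply: below_trans wu (below_parent u).
Qed.

Lemma below_child_neq u v w : u \in children v -> below w u -> w != v.
Proof.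
move=> uv /below_depth; rewrite (depth_child uv).
by apply: contraTneq => ->; rewrite ltnn.
Qed.

Lemma below_split w v : below w v -> w != v -> exists2 u, u \in children v & below w u.
Proof.
case/belowP => -[|k] lek ->; first by rewrite eqxx.
move=> _; exists (iter k (@parent t) w); last exact: fconnect_iter.
apply/childrenP; split=> //; rewrite -depth_eq0 depth_iter -lt0n subn_gt0 //.
Qed.

Lemma below_child_inj u u' v w : u \in children v -> u' \in children v ->
  below w u -> below w u' -> u = u'.
Proof.
by move=> uv uv' wu wu'; apply: (below_depth_inj wu wu'); rewrite (depth_child uv) (depth_child uv').
Qed.

Definition deepest_first : seq t := sort (fun u v => depth v <= depth u)%N (enum t).

Lemma deepest_first_mem v : v \in deepest_first.
Proof. by rewrite mem_sort mem_enum. Qed.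

Lemma deepest_first_uniq : uniq deepest_first.
Proof. by rewrite sort_uniq enum_uniq. Qed.

(** The ancestors of [v] have distinct depths, so only one ordering of them is sorted by depth. *)
Lemma filter_below_deepest_first v :
  filter (below v) deepest_first = traject (@parent t) v (depth v).+1.
Proof.
pose le u w := (depth w <= depth u)%N.
have le_trans : transitive le by move=> a b c ab bc; apply: leq_trans bc ab.
apply: (@sorted_eq_in _ le).
- by move=> a b c _ _ _; apply: le_trans.
- move=> a b; rewrite !mem_filter => /andP[va _] /andP[vb _] ab.
  by apply: (below_depth_inj va vb); apply/eqP; rewrite eqn_leq andbC.
- by apply: sorted_filter => //; apply: sort_sorted => a b; apply: leq_total.
- have le_path k u : path le u (traject (@parent t) (parent u) k).
    elim: k u => //= k IH u; rewrite IH andbT /le.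
    by have := depth_iter 1 u => /= ->; apply: leq_subr.
  exact: le_path.
apply: uniq_perm; first by rewrite filter_uniq ?deepest_first_uniq.
  apply/(uniqP v) => i j; rewrite !inE size_traject => li lj.
  rewrite !nth_traject // => /(congr1 depth); rewrite !depth_iter => e.
  by rewrite -(subKn (n := depth v) (m := i)) -1?ltnS // e subKn // -ltnS.
move=> u; rewrite mem_filter deepest_first_mem andbT.
apply/belowP/trajectP => [[k lek ->]|[k lek ->]]; exists k => //.
Qed.

Lemma prod_telescope n (G : t -> 'S_n) v :
  (\prod_(u <- deepest_first | below v u)
     (if u == root then G u else G u * (G (parent u))^-1) = G v)%g.
Proof.
rewrite -big_filter filter_below_deepest_first.
have [k] : exists k, depth v = k by exists (depth v).
elim: k v => [|k IH] v dv.
  by rewrite dv big_seq1 -depth_eq0 dv.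
have nr : v != root by rewrite -depth_eq0 dv.
have dp : depth (parent v) = k by move: dv; rewrite depth_parent // => -[].
by rewrite dv trajectS big_cons (negbTE nr) -dp IH // mulgKV.
Qed.

End TreeOrder.

(** * Monomials modulo the minors of the flattenings *)

Section IdealClosure.
Variable A : comNzRingType.
Implicit Types (S : set A) (p q : A).

Lemma ideal_gen0 S : ideal_gen S 0.
Proof. by exists 0%N, (fun _ => 0), (fun _ => 0); split => [[]//|]; rewrite big_ord0. Qed.

Lemma ideal_gen_mem S p : S p -> ideal_gen S p.
Proof.
by move=> Sp; exists 1%N, (fun _ => 1), (fun _ => p); rewrite big_ord1 mul1r.
Qed.

Lemma ideal_genMl S p q : ideal_gen S q -> ideal_gen S (p * q).
Proof.
case=> n [a [s [Ss ->]]]; exists n, (fun i => p * a i), s; split=> //.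
by rewrite mulr_sumr; apply: eq_bigr => i _; rewrite mulrA.
Qed.

Lemma ideal_genD S p q : ideal_gen S p -> ideal_gen S q -> ideal_gen S (p + q).
Proof.
case=> n [a [s [Ss ->]]] [m [b [u [Su ->]]]].
pose sel (T : Type) (f : 'I_n -> T) (g : 'I_m -> T) (i : 'I_(n + m)) :=
  match fintype.split i with inl j => f j | inr j => g j end.
exists (n + m)%N, (sel _ a b), (sel _ s u); split.
  by move=> i; rewrite /sel; case: fintype.splitP.
rewrite big_split_ord; congr (_ + _); apply: eq_bigr => i _; rewrite /sel.
  by case: fintype.splitP => [j|j] e; [congr (_ * _); congr (_ _); apply/val_inj
    |have := ltn_ord i; rewrite /= in e; rewrite e ltnNge leq_addr].
case: fintype.splitP => [j|j] /= e; first by have := ltn_ord j; rewrite -e ltnNge leq_addr.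
by move/addnI: e => e; congr (_ * _); congr (_ _); apply/val_inj.
Qed.

Lemma ideal_gen_sum S (I : Type) (l : seq I) (P : pred I) (F : I -> A) :
  (forall i, P i -> ideal_gen S (F i)) -> ideal_gen S (\sum_(i <- l | P i) F i).
Proof.
move=> SF; elim/big_rec: _ => [|i x Pi]; first exact: ideal_gen0.
by apply: ideal_genD; apply: SF.
Qed.

Variables (I : finType) (P : pred I) (S : I -> set A).
Local Notation Sum := (ideal_sum P (fun i => ideal_gen (S i))).

Lemma ideal_sum0 : Sum 0.
Proof. by exists (fun _ => 0); split=> [i _|]; rewrite ?big1 //; apply: ideal_gen0. Qed.

Lemma ideal_sum_mem i p : P i -> ideal_gen (S i) p -> Sum p.
Proof.
move=> Pi Sp; exists (fun j => if j == i then p else 0); split=> [j _|].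
  by case: eqP => [->|_] //; apply: ideal_gen0.
by rewrite (bigD1 i) //= eqxx big1 ?addr0 // => j /andP[_ /negbTE ->].
Qed.

Lemma ideal_sumMl p q : Sum q -> Sum (p * q).
Proof.
case=> f [Sf ->]; exists (fun i => p * f i); split; last by rewrite mulr_sumr.
by move=> i /Sf; apply: ideal_genMl.
Qed.

Lemma ideal_sumD p q : Sum p -> Sum q -> Sum (p + q).
Proof.
case=> f [Sf ->] [g [Sg ->]]; exists (fun i => f i + g i); split.
  by move=> i Pi; apply: ideal_genD; [apply: Sf | apply: Sg].
by rewrite big_split.
Qed.

Lemma ideal_sum_sum (T : Type) (l : seq T) (Q : pred T) (F : T -> A) :
  (forall i, Q i -> Sum (F i)) -> Sum (\sum_(i <- l | Q i) F i).
Proof.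
move=> SF; elim/big_rec: _ => [|i x Pi]; first exact: ideal_sum0.
by apply: ideal_sumD; apply: SF.
Qed.

End IdealClosure.

Section ArbitraryMinors.
Variable A : comNzRingType.

Lemma increasing_reorder k m (f : 'I_k -> 'I_m) : injective f ->
  exists s : 'S_k, {homo (fun i => f (s i)) : i j / (i < j)%N}.
Proof.
(* [q i] is the position of [f i] in the sorted list of values, so the inverse of [Q] sorts [f]. *)
move=> f_inj; pose q i := #|[set j | (f j < f i)%N]|.
have q_lt i : (q i < k)%N.
  rewrite -[X in (_ < X)%N]card_ord -cardsT; apply: proper_card; apply/properP.
  by split; [apply: finset.subsetT | exists i; rewrite !inE // ltnn].
have q_mono i j : (f i < f j)%N -> (q i < q j)%N.
  move=> lt; apply: proper_card; apply/properP; split.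
    by apply/fintype.subsetP => l; rewrite !inE => /ltn_trans; apply.
  by exists i; rewrite !inE ?lt // ltnn.
pose Q i := Ordinal (q_lt i).
have Q_inj : injective Q.
  move=> i j /(congr1 val) /= e; apply: f_inj; apply: val_inj => /=.
  by case: (ltngtP (f i) (f j)) => // /q_mono; rewrite e ltnn.
exists (perm Q_inj)^-1%g => i j lt.
set s := (perm Q_inj)^-1%g.
have qs l : q (s l) = l by rewrite -[RHS](congr1 val (permKV (perm Q_inj) l)) /= permE.
case: (ltngtP (f (s i)) (f (s j))) => // [/q_mono|/val_inj/f_inj/perm_inj e].
  by rewrite !qs ltnNge ltnW.
by rewrite e ltnn in lt.
Qed.

(** [minors] admits increasing selections only. A repeated row or column makes the determinant 0;
    otherwise sorting changes it by a sign. *)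
Lemma det_mxsub_minors k m n (M : 'M[A]_(m, n)) (f : 'I_k -> 'I_m) (g : 'I_k -> 'I_n) :
  ideal_gen (minors k M) (\det (mxsub f g M)).
Proof.
have [f_inj|] := pselect (injective f); last first.
  move=> f_ninj; have [i [j [ij fij]]] : exists i j, i != j /\ f i = f j.
    apply: contrapT => H; apply: f_ninj => i j fij; apply/eqP/negPn/negP => ij.
    by apply: H; exists i, j.
  rewrite (determinant_alternate ij) ?fij; first exact: ideal_gen0.
  by move=> l; rewrite !mxE fij.
have [g_inj|] := pselect (injective g); last first.
  move=> g_ninj; have [i [j [ij gij]]] : exists i j, i != j /\ g i = g j.
    apply: contrapT => H; apply: g_ninj => i j gij; apply/eqP/negPn/negP => ij.
    by apply: H; exists i, j.
  rewrite -det_tr (determinant_alternate ij); first exact: ideal_gen0.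
  by move=> l; rewrite !mxE gij.
have [s hs] := increasing_reorder f_inj.
have [u hu] := increasing_reorder g_inj.
have -> : mxsub f g M =
    perm_mx s^-1 *m mxsub (fun i => f (s i)) (fun i => g (u i)) M *m perm_mx u.
  by rewrite -row_permE -[perm_mx u](congr1 perm_mx (invgK u)) -col_permE; apply/matrixP => i j; rewrite !mxE !permKV.
rewrite !det_mulmx mulrC mulrA; apply: ideal_genMl; apply: ideal_gen_mem.
by exists (fun i => f (s i)), (fun i => g (u i)).
Qed.

End ArbitraryMinors.

(** * Permutations at the leaves acting on monomials *)

Section Monomials.
Variables (R : realType) (t : rooted_tree) (d : t -> nat).
Local Notation C := R[i].
Local Notation root := (root_vertex t).
Local Notation entry := (multi_index d (leaves_below root)).
Local Notation Cpsi := {mpoly C[#|{: entry}|]}.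

Lemma leaves_belowE (v l : t) : l \in leaves t -> (l \in leaves_below v) = below l v.
Proof. by move=> hl; rewrite !inE -[in RHS]/(below l v); move: hl; rewrite inE => ->. Qed.

Lemma leaves_below_sub_root (v : t) : leaves_below v \subset leaves_below root.
Proof. by rewrite leaves_below_root; apply/fintype.subsetP => l; rewrite 2!inE => /andP[]. Qed.

Lemma entry_leaf (x : {l | l \in leaves_below root}) : val x \in leaves t.
Proof. by rewrite -leaves_below_root (valP x). Qed.

Variable n : nat.
Implicit Types (J : {ffun 'I_n -> entry}) (G : t -> 'S_n).

Definition mon J : Cpsi := \prod_i psi R (J i).

(** Only the values of [G] at leaves matter here; [G] is defined on all vertices because the
    families summed over later carry permutations at internal vertices too. *)
Definition leaf_act J G : {ffun 'I_n -> entry} :=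
  [ffun i => finfun (fun x : {l | l \in leaves_below root} =>
     J (G (val x) i) x : 'I_(d (val x)))].

Definition twist (v : t) (s : 'S_n) (l : t) : 'S_n := if below l v then s else 1%g.

Lemma leaf_actE J G i x : leaf_act J G i x = J (G (val x) i) x.
Proof. by rewrite !ffunE. Qed.

Lemma eq_leaf_act J G G' : {in leaves t, G =1 G'} -> leaf_act J G = leaf_act J G'.
Proof.
move=> e; apply/ffunP => i; apply/ffunP => x; rewrite !leaf_actE e //.
exact: entry_leaf.
Qed.

Lemma leaf_actM J G G' : leaf_act (leaf_act J G) G' = leaf_act J (fun l => G' l * G l)%g.
Proof. by apply/ffunP => i; apply/ffunP => x; rewrite !leaf_actE permM. Qed.

Lemma leaf_act1 J : leaf_act J (fun _ => 1%g) = J.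
Proof. by apply/ffunP => i; apply/ffunP => x; rewrite !leaf_actE perm1. Qed.

Lemma mon_act_diag J (s : 'S_n) : mon (leaf_act J (fun _ => s)) = mon J.
Proof.
rewrite /mon [RHS](reindex_inj (@perm_inj _ s)) /=; apply: eq_bigr => i _.
by congr (psi R _); apply/ffunP => x; rewrite leaf_actE.
Qed.

Lemma mon_act_twist_root J (s : 'S_n) : mon (leaf_act J (twist root s)) = mon J.
Proof.
rewrite -[RHS](mon_act_diag _ s); congr mon; apply: eq_leaf_act => l _.
by rewrite /twist below_root.
Qed.

Lemma psi_act_twist (v : t) J (s : 'S_n) i :
  psi R (leaf_act J (twist v s) i) = flattening R d v
    (enum_rank (restrict_index (leaves_below_sub_root v) (J (s i))))
    (enum_rank (restrict_index (finset.subsetDl (leaves_below root) (leaves_below v)) (J i))).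
Proof.
rewrite mxE !enum_rankK; congr (psi R _); apply/ffunP => x.
rewrite leaf_actE ffunE /twist -(leaves_belowE _ (entry_leaf x)).
case: {-}_ / boolP => [xv|xv].
  rewrite xv ffunE; move: (fintype.subsetP _ _ _) => /= h.
  by case: x xv h => l hl xv h; rewrite (bool_irrelevance h hl).
rewrite (ifN _ _ xv) perm1 ffunE /=; move: (fintype.subsetP _ _ _) => /= h.
by case: x xv h => l hl xv h; rewrite (bool_irrelevance h hl).
Qed.

Lemma leaf_act_twist1 (v : t) J : leaf_act J (twist v 1) = J.
Proof. by rewrite -[RHS]leaf_act1; apply: eq_leaf_act => l _; rewrite /twist if_same. Qed.

(** By [psi_act_twist] the permutation affects only the row of each flattening entry. Positions
    outside [h] factor out, and the signed sum over the others is the Leibniz formula of a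
    transposed submatrix. *)
Lemma mon_antisymmetrizer (v : t) J k (h : 'I_k -> 'I_n) (h_inj : injective h) :
  ideal_gen (minors k (flattening R d v))
    (\sum_(p : 'S_k) (-1) ^+ p *: mon (leaf_act J (twist v (extend_perm h_inj p)))).
Proof.
pose row i := enum_rank (restrict_index (leaves_below_sub_root v) (J i)).
pose col i := enum_rank
  (restrict_index (finset.subsetDl (leaves_below root) (leaves_below v)) (J i)).
pose M := mxsub (row \o h) (col \o h) (flattening R d v).
have -> : \sum_(p : 'S_k) (-1) ^+ p *: mon (leaf_act J (twist v (extend_perm h_inj p))) =
    (\prod_(i | i \notin codom h) psi R (J i)) * \det M^T.
  rewrite mulr_sumr; apply: eq_bigr => p _.
  rewrite mulrCA mulr_sign scaler_sign.
  suff -> : mon (leaf_act J (twist v (extend_perm h_inj p))) =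
      (\prod_(i | i \notin codom h) psi R (J i)) * \prod_a M^T a (p a) by [].
  rewrite /mon (bigID [pred i | i \notin codom h]) /=; congr (_ * _).
    apply: eq_bigr => i hi; rewrite psi_act_twist extend_perm_out.
      by rewrite -[in RHS](leaf_act_twist1 v J) psi_act_twist perm1.
    by move=> a; apply: contraNneq hi => <-; apply: codom_f.
  rewrite (eq_bigl (mem [set h a | a in 'I_k])); last first.
    by move=> i; rewrite negbK /=; apply/codomP/imsetP => [[a ->]|[a _ ->]]; exists a.
  rewrite big_imset /=; last by move=> a b _ _; apply: h_inj.
  by apply: eq_bigr => a _; rewrite psi_act_twist !mxE extend_perm_in.
by rewrite det_tr; apply: ideal_genMl; apply: det_mxsub_minors.
Qed.

End Monomials.

(** * Straightening monomials at all vertices *)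

Section Straightening.
Variables (R : realType) (t : rooted_tree) (d r : t -> nat).
Local Notation C := R[i].
Local Notation root := (root_vertex t).
Local Notation entry := (multi_index d (leaves_below root)).
Local Notation Cpsi := {mpoly C[#|{: entry}|]}.

Variables (n N : nat).
Hypothesis rank_le : forall v, (rank_at r v <= N.+1)%N.
Local Notation word := {ffun 'I_n -> 'I_N.+1}.
Local Notation words := (word * word)%type.

Local Notation perms := {ffun t -> 'S_n}.

Local Notation minors_ideal := (ideal_sum (fun v : t => v != root)
  (fun v : t => ideal_gen (minors (r v).+1 (flattening R d v)))).

Implicit Types (J : {ffun 'I_n -> entry}) (S G : perms).

Lemma minors_idealZ (a : C) (p : Cpsi) : minors_ideal p -> minors_ideal (a *: p).
Proof. by rewrite -mul_mpolyC; apply: ideal_sumMl. Qed.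

(** Away from the root, this is [identity_mod_antisymmetrizers] with [P] saying that the
    combination, acting below [v], sends every monomial into the ideal. *)
Lemma mon_straighten_vertex (v : t) : exists c : words -> C,
  (forall w, c w != 0 ->
     colours_below (rank_at r v) w.1 && colours_below (rank_at r v) w.2) /\
  forall J, minors_ideal (mon R J -
    \sum_s (\sum_w c w * (word_perm w.1 s == w.2)%:R) *: mon R (leaf_act J (twist v s))).
Proof.
have [->|nr] := eqVneq v root.
  (* All leaves lie below the root, so [twist root s] only reorders the factors and averaging over
     the group is exact; a single colour suffices, matching rank 1. *)
  pose z : word := [ffun => ord0].
  exists (fun w => if w == (z, z) then #|{: 'S_n}|%:R^-1 else 0); split.
    move=> [x y]; case: (eqVneq (x, y) (z, z)) => [[-> ->] _|_]; last by rewrite eqxx.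
    by rewrite /rank_at eqxx; apply/andP; split; apply/forallP => i; rewrite ffunE.
  move=> J; rewrite [X in _ - X](_ : _ = mon R J) ?subrr; first exact: ideal_sum0.
  transitivity (\sum_(s : 'S_n) #|{: 'S_n}|%:R^-1 *: mon R J).
    apply: eq_bigr => s _; rewrite mon_act_twist_root (bigD1 (z, z)) //= eqxx.
    rewrite (_ : word_perm z s == z) ?mulr1 ?big1 ?addr0 // => [w /negbTE ->|].
      by rewrite mul0r.
    by apply/eqP/ffunP => i; rewrite !ffunE.
  rewrite sumr_const -scaler_nat scalerA mulfV ?scale1r // pnatr_eq0 -lt0n.
  by apply/card_gt0P; exists 1%g.
have rv : rank_at r v = r v by rewrite /rank_at (negbTE nr).
have rvN : (r v <= N.+1)%N by rewrite -rv.
have [c [cv cP]] := identity_mod_antisymmetrizers C n rvN.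
exists (fun w => c w.1 w.2); split; first by move=> [x y] /cv; rewrite rv.
pose P (a : 'S_n -> C) := forall J, minors_ideal (\sum_s a s *: mon R (leaf_act J (twist v s))).
move=> J.
suff : P (fun s => (s == 1%g)%:R - \sum_x \sum_y c x y * (word_perm x s == y)%:R).
  move/(_ J); rewrite [X in minors_ideal X -> _](_ : _ = mon R J -
    \sum_s (\sum_w c w.1 w.2 * (word_perm w.1 s == w.2)%:R) *:
      mon R (leaf_act J (twist v s))) //.
  under eq_bigr do rewrite scalerBl pair_bigA; rewrite sumrB; congr (_ - _).
  rewrite (bigD1 1%g) //= eqxx scale1r leaf_act_twist1 big1 ?addr0 // => s /negbTE ->.
  by rewrite scale0r.
apply: cP => [a b ab Pa K|K|a e h h_inj u Pa K].
- by move: (Pa K); under eq_bigr do rewrite ab.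
- by rewrite big1 => [|s _]; rewrite ?scale0r //; apply: ideal_sum0.
under eq_bigr do rewrite scalerDl -scalerA.
rewrite big_split; apply: ideal_sumD; first exact: Pa.
rewrite -scaler_sumr; apply: minors_idealZ.
under eq_bigr do rewrite scaler_suml.
rewrite exchange_big /= (eq_bigr (fun p : 'S_(r v).+1 => (-1) ^+ p *:
    mon R (leaf_act (leaf_act K (twist v u)) (twist v (extend_perm h_inj p))))).
  by apply: (ideal_sum_mem (i := v)) => //; apply: mon_antisymmetrizer.
move=> p _; rewrite (bigD1 (extend_perm h_inj p * u)%g) //= eqxx mulr1.
rewrite big1 ?addr0 => [|s /negbTE ->]; last by rewrite mulr0 scale0r.
congr (_ *: mon R _); rewrite leaf_actM; apply: eq_leaf_act => l _.
by rewrite /twist; case: below; rewrite ?mulg1.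
Qed.

Definition update S (v : t) (s : 'S_n) : perms :=
  [ffun u => if u == v then s else S u].

(** Separates the summation variable at [v] from the others, with 1 as its placeholder. *)
Lemma sum_update (V : nmodType) (v : t) (F : perms -> 'S_n -> V) :
  (forall S s, F S s = F (update S v 1%g) s) ->
  \sum_(S : perms) F S (S v) = \sum_(S : perms | S v == 1%g) \sum_s F S s.
Proof.
move=> FE; rewrite pair_big_dep /=.
rewrite (reindex_onto (fun S => (update S v 1%g, S v)) (fun q => update q.1 v q.2)) /=.
  rewrite (eq_bigl xpredT) => [|S].
    by apply: eq_bigr => S _; rewrite -FE.
  rewrite ffunE !eqxx /=; apply/eqP/ffunP => u; rewrite !ffunE.
  by case: eqP => [->|].
move=> [S s] /= /andP[/eqP S1 _]; congr (_, _); last by rewrite ffunE eqxx.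
by apply/ffunP => u; rewrite !ffunE; case: eqP => [->|//].
Qed.

Section Iterate.
Variable D : t -> 'S_n -> C.
Hypothesis D_straighten : forall v J,
  minors_ideal (mon R J - \sum_s D v s *: mon R (leaf_act J (twist v s))).

(** Outside [s] the weight is a Kronecker delta at 1, so the same index set serves every list in the
    induction. *)
Definition list_weight (s : seq t) S : C :=
  \prod_v (if v \in s then D v (S v) else (S v == 1%g)%:R).

(** The tail is straightened first; the head [v] then contributes a left factor to the permutation
    at each leaf below [v]. *)
Lemma mon_straighten_list (s : seq t) J : uniq s -> minors_ideal (mon R J -
  \sum_(S : perms) list_weight s S *: mon R (leaf_act J (fun l => \prod_(v <- s | below l v) S v)%g)).
Proof.
elim: s => [_|v s IH /= /andP[vs us]].
  rewrite (bigD1 [ffun => 1%g]) //= big1 => [|S nS].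
    rewrite /list_weight big1 => [|v _]; last by rewrite ffunE eqxx.
    rewrite scale1r addr0 (_ : leaf_act J _ = J) ?subrr; first exact: ideal_sum0.
    by rewrite -[RHS]leaf_act1; apply: eq_leaf_act => l _; rewrite big_nil.
  have [v Sv] : exists v, S v != 1%g.
    apply/existsP; apply: contraR nS; rewrite negb_exists => /forallP H.
    by apply/eqP/ffunP => v; rewrite ffunE; apply/eqP; move: (H v); rewrite negbK.
  by rewrite /list_weight (bigD1 v) //= (negbTE Sv) mul0r scale0r.
pose path S : t -> 'S_n := fun l => (\prod_(v <- s | below l v) S v)%g.
pose rest S := \prod_(u | u != v) (if u \in s then D u (S u) else (S u == 1%g)%:R) : C.
have weight_cons S : list_weight (v :: s) S = rest S * D v (S v).
  rewrite /list_weight (bigD1 v) //= mem_head mulrC; congr (_ * _).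
  by apply: eq_bigr => u uv; rewrite inE (negbTE uv).
have weight S : list_weight s S = rest S * (S v == 1%g)%:R.
  by rewrite /list_weight (bigD1 v) //= (negbTE vs) mulrC.
have restE S s' : rest (update S v s') = rest S.
  by apply: eq_bigr => u uv; rewrite ffunE (negbTE uv).
have pathE S s' l : path (update S v s') l = path S l.
  rewrite /path big_seq_cond [RHS]big_seq_cond; apply: eq_bigr => u /andP[us' _].
  by rewrite ffunE; case: eqP us' vs => // -> ->.
pose F S s' := (rest S * D v s') *: mon R (leaf_act (leaf_act J (path S)) (twist v s')).
have -> : \sum_(S : perms) list_weight (v :: s) S *:
      mon R (leaf_act J (fun l => \prod_(v0 <- v :: s | below l v0) S v0)%g) =
    \sum_(S : perms) list_weight s S *: \sum_s' D v s' *: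
      mon R (leaf_act (leaf_act J (path S)) (twist v s')).
  transitivity (\sum_(S : perms) F S (S v)).
    apply: eq_bigr => S _; rewrite weight_cons; congr (_ *: mon R _).
    rewrite leaf_actM; apply: eq_leaf_act => l _; rewrite /twist big_cons.
    by case: below; rewrite ?mul1g.
  rewrite sum_update => [|S s']; last first.
    rewrite /F; have -> : leaf_act J (path (update S v 1%g)) = leaf_act J (path S).
      by apply: eq_leaf_act => l _; rewrite pathE.
    by rewrite restE.
  rewrite [RHS](bigID (fun S : perms => S v == 1%g)) /=.
  rewrite [X in _ = _ + X]big1 ?addr0 => [|S /negbTE S1]; last first.
    by rewrite weight S1 mulr0 scale0r.
  apply: eq_bigr => S /eqP S1; rewrite weight S1 eqxx mulr1 scaler_sumr.
  by apply: eq_bigr => s' _; rewrite scalerA.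
rewrite -[X in X - _](subrK (\sum_(S : perms) list_weight s S *: mon R (leaf_act J (path S)))) -addrA.
apply: ideal_sumD; first exact: IH.
rewrite -sumrB; apply: ideal_sum_sum => S _.
by rewrite -scalerBr; apply: minors_idealZ; apply: D_straighten.
Qed.

Definition edge_perm G (v : t) : 'S_n :=
  if v == root then G v else (G v * (G (parent v))^-1)%g.

(** [edge_perm] is a bijective change of variables, since by [prod_telescope] the products along
    paths recover [G]. *)
Lemma mon_straighten J : minors_ideal (mon R J -
  \sum_(G : perms) (\prod_v D v (edge_perm G v)) *: mon R (leaf_act J G)).
Proof.
have := mon_straighten_list J (deepest_first_uniq t).
pose h G : perms := [ffun v => edge_perm G v].
have h_path G l : (\prod_(v <- deepest_first t | below l v) h G v = G l)%g.
  rewrite -[RHS](prod_telescope G l); apply: eq_bigr => v _.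
  by rewrite ffunE /edge_perm.
have h_inj : injective h.
  by move=> G G' e; apply/ffunP => l; rewrite -[LHS]h_path e h_path.
rewrite (reindex_inj h_inj) /=.
rewrite (eq_bigr (fun G : perms =>
  (\prod_v D v (edge_perm G v)) *: mon R (leaf_act J G))) // => G _.
have -> : list_weight (deepest_first t) (h G) = \prod_v D v (edge_perm G v).
  by apply: eq_bigr => v _; rewrite deepest_first_mem ffunE.
have -> // : leaf_act J (fun l => \prod_(v <- deepest_first t | below l v) h G v)%g =
    leaf_act J G.
by apply: eq_leaf_act => l _; rewrite h_path.
Qed.

End Iterate.

(** The [i]-th network uses copy [G v i] of the tensor at [v]. On the edge above [v], [(X v).1]
    colours the slots of the parent copies and [(X v).2] those of the copies at [v]. *)
Definition compatible (X : t -> words) G : bool :=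
  [forall v, (v != root) ==>
     [forall i, (X v).1 (G (parent v) i) == (X v).2 (G v i)]].

(** Collecting the straightened monomials by [J] moves the permutations onto [F]. Once [D] is
    expanded into words, each coefficient is a combination of the sums assumed to vanish, and only
    the errors of straightening remain. *)
Lemma straightened_mem (F : {ffun 'I_n -> entry} -> C) :
    (forall (X : {ffun t -> words}) J,
       (forall v, colours_below (rank_at r v) (X v).1 &&
                  colours_below (rank_at r v) (X v).2) ->
       \sum_(G : perms | compatible X G) F (leaf_act J G) = 0) ->
  minors_ideal (\sum_J F J *: mon R J).
Proof.
move=> F0.
have [c cP] := choice mon_straighten_vertex.
pose D v s := \sum_w c v w * (word_perm w.1 s == w.2)%:R.
have Dst v J : minors_ideal (mon R J - \sum_s D v s *: mon R (leaf_act J (twist v s))).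
  by have [_] := cP v; apply.
pose inv G : perms := [ffun v => (G v)^-1%g].
have invK : involutive inv by move=> G; apply/ffunP => v; rewrite !ffunE invgK.
have act_inv G : cancel (fun J => leaf_act J G) (fun J => leaf_act J (inv G)).
  move=> J; rewrite leaf_actM -[RHS]leaf_act1; apply: eq_leaf_act => l _.
  by rewrite ffunE mulVg.
have -> : \sum_J F J *: mon R J = \sum_J F J *: (mon R J -
    \sum_(G : perms) (\prod_v D v (edge_perm G v)) *: mon R (leaf_act J G)).
  apply/eqP; rewrite -subr_eq0 -sumrB; apply/eqP.
  transitivity (\sum_J \sum_(G : perms) (F J * \prod_v D v (edge_perm G v)) *: mon R (leaf_act J G)).
    apply: eq_bigr => J _; rewrite -scalerBr subKr scaler_sumr.
    by apply: eq_bigr => G _; rewrite scalerA.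
  rewrite exchange_big /= (reindex_inj (can_inj invK)) /=.
  under eq_bigr => G _.
    rewrite (reindex_inj (can_inj (act_inv G))) /=.
    under eq_bigr do rewrite act_inv.
    over.
  rewrite exchange_big /= big1 // => J _; rewrite -scaler_suml.
  apply/eqP; rewrite scaler_eq0; apply/orP; left; apply/eqP.
  under eq_bigr do rewrite /D bigA_distr_bigA mulr_sumr.
  rewrite exchange_big /= big1 // => X _.
  have [/forallP vX|] := boolP [forall v, c v (X v) != 0]; last first.
    rewrite negb_forall => /existsP[v]; rewrite negbK => /eqP cv.
    by apply: big1 => G _; rewrite (bigD1 v) //= cv !mul0r mulr0.
  have vP v := (cP v).1 _ (vX v).
  have bits G : \prod_v (word_perm (X v).1 (edge_perm (inv G) v) == (X v).2)%:R =
      (compatible X G)%:R :> C.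
    have edge v : (word_perm (X v).1 (edge_perm (inv G) v) == (X v).2) =
        (v != root) ==> [forall i, (X v).1 (G (parent v) i) == (X v).2 (G v i)].
      rewrite /edge_perm !ffunE invgK; have [vr|nr] /= := eqVneq v root.
        (* At the root both words are constantly 0, so no condition arises. *)
        have /andP[/forallP x1 /forallP y1] := vP v.
        apply/eqP/ffunP => i; apply: val_inj; rewrite ffunE /=.
        move: (x1 (inv G v i)) (y1 i); rewrite /rank_at vr eqxx !ltnS !leqn0.
        by rewrite !ffunE => /eqP -> /eqP ->.
      apply/eqP/forallP => [/ffunP e i|e].
        by rewrite -e ffunE permM permK.
      apply/ffunP => i; rewrite ffunE permM.
      by move: (e ((G v)^-1 i)%g) => /eqP ->; rewrite permKV.
    have [/forallP cG|] := boolP (compatible X G).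
      by rewrite big1 // => v _; rewrite edge cG.
    rewrite negb_forall => /existsP[v nv].
    by rewrite (bigD1 v) //= edge (negbTE nv) mul0r.
  transitivity (\sum_(G : perms) (\prod_v c v (X v)) * ((compatible X G)%:R * F (leaf_act J G))).
    apply: eq_bigr => G _; rewrite big_split /= mulrC -mulrA; congr (_ * (_ * _)).
    exact: bits.
  rewrite -mulr_sumr -[X in _ * X](_ : \sum_(G : perms | compatible X G) F (leaf_act J G) = _).
    by rewrite F0 ?mulr0.
  rewrite big_mkcond; apply: eq_bigr => G _.
  by case: compatible; rewrite ?mul1r ?mul0r.
by apply: ideal_sum_sum => J _; apply: minors_idealZ; apply: mon_straighten.
Qed.

End Straightening.

(** * The parametrization of tree tensor networks *)

Section WordOrbits.
Variables (T K : finType) (n : nat) (tag : K -> T).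
Local Notation perms := {ffun T -> 'S_n}.
Implicit Types (w : T -> 'I_n -> K) (G : perms).

Definition letter_count w (a : K) : nat := \sum_(q : T * 'I_n) (w q.1 q.2 == a).

Lemma prod_letters (C : comNzRingType) (P : K -> C) w :
  \prod_(q : T * 'I_n) P (w q.1 q.2) = \prod_a P a ^+ letter_count w a.
Proof.
under [RHS]eq_bigr do rewrite -prodrXr.
rewrite exchange_big /=; apply: eq_bigr => q _.
rewrite (bigD1 (w q.1 q.2)) //= eqxx expr1 big1 ?mulr1 // => a.
by rewrite eq_sym => /negbTE ->.
Qed.

Definition transports w w' G : bool := [forall v, forall i, w v i == w' v (G v i)].

Lemma transportsP w w' G :
  reflect (forall v i, w v i = w' v (G v i)) (transports w w' G).
Proof.
apply: (iffP forallP) => [h v i|h v]; first by apply/eqP; move/forallP: (h v).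
by apply/forallP => i; apply/eqP.
Qed.

(** [tag] keeps letters of different vertices apart, so equal counts make the two words at each
    vertex rearrangements of each other. *)
Lemma letter_countP w w' :
  (forall v i, tag (w v i) = v) -> (forall v i, tag (w' v i) = v) ->
  reflect (exists G, transports w w' G)
    [forall a, letter_count w a == letter_count w' a].
Proof.
move=> tw tw'; apply: (iffP forallP) => [eqc|[G /transportsP e] a]; last first.
  have tr_inj : injective (fun q : T * 'I_n => (q.1, G q.1 q.2)).
    by move=> [v i] [u j] [-> /perm_inj ->].
  rewrite /letter_count [X in _ == X](reindex_inj tr_inj) /=; apply/eqP.
  by apply: eq_bigr => q _; rewrite e.
have letters x v a : (forall v i, tag (x v i) = v) -> tag a = v ->
    count_mem a [tuple x v i | i < n] = letter_count x a.
  move=> tx ta; rewrite /letter_count count_map -sum1_count big_enum_cond.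
  rewrite (bigID (fun q : T * 'I_n => q.1 == v)) /= [X in (_ + X)%N]big1 ?addn0.
    rewrite (eq_bigl (fun q : T * 'I_n => (q.1 == v) && xpredT q.2)) => [|q]; last by rewrite andbT.
    rewrite -(pair_big (pred1 v) xpredT (fun u i => nat_of_bool (x u i == a))) /=.
    by rewrite big_pred1_eq [RHS](eq_bigr (fun i => if x v i == a then 1%N else 0%N)) -?big_mkcond //; apply: eq_bigr => i _; case: eqP.
  move=> [u i] /= uv; case: eqP => // e; case/eqP: uv.
  by rewrite -(tx u i) e.
have /(_ _)/cid G_ v : exists s : 'S_n, forall i, w v i = w' v (s i).
  have : perm_eq [tuple w v i | i < n] [tuple w' v i | i < n].
    apply/allP => a /=; rewrite mem_cat => ain.
    have ta : tag a = v by case/orP: ain => /mapP[i _ ->].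
    by rewrite !(letters _ v a) //; apply: eqc.
  case/tuple_permP => s /val_inj e; exists s => i.
  by have := congr1 (fun u => tnth u i) e; rewrite !tnth_mktuple.
by exists [ffun v => sval (G_ v)]; apply/transportsP => v i; rewrite ffunE; case: (G_ v).
Qed.

(** The families carrying [w] to [w'] are either absent or a coset of the stabilizer of [w']. *)
Lemma sum_transports w w' :
  (forall v i, tag (w v i) = v) -> (forall v i, tag (w' v i) = v) ->
  (\sum_G transports w w' G =
    [forall a, letter_count w a == letter_count w' a] * \sum_G transports w' w' G)%N.
Proof.
move=> tw tw'; have [[G0 G0P]|nG] := letter_countP tw tw'; last first.
  by rewrite mul0n big1 // => G _; apply/eqP; rewrite eqb0; apply/negP => GP; case: nG; exists G.
have mul_inj : injective (fun G => [ffun v => G0 v * G v]%g : perms).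
  by move=> G G' /ffunP e; apply/ffunP => v; apply: (mulgI (G0 v)); have := e v; rewrite !ffunE.
rewrite mul1n (reindex_inj mul_inj) /=; apply: eq_bigr => G _; congr nat_of_bool.
move/transportsP: G0P => G0P.
apply/transportsP/transportsP => e v i.
  by rewrite -{1}(permKV (G0 v) i) -G0P e ffunE permM permKV.
by rewrite G0P e ffunE permM.
Qed.

End WordOrbits.

Section Parametrization.
Variables (R : realType) (t : rooted_tree) (d r : t -> nat) (N : nat).
Hypothesis d_le : forall l, l \in leaves t -> (d l <= N.+1)%N.
Local Notation C := R[i].
Local Notation root := (root_vertex t).
Local Notation entry := (multi_index d (leaves_below root)).
Local Notation colouring := {ffun t -> 'I_N.+1}.

(* A variable indexed by [(v, a, c, k)] is an entry of the tensor at [v]: [a] is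
   the colour of the edge above [v], [c] the colours of the edges to the children
   (0 at the other vertices), and [k] the physical index if [v] is a leaf (0
   otherwise). *)
Definition parameter : finType := (t * 'I_N.+1 * colouring * 'I_N.+1)%type.

(** Padding by 0 off [A] makes indices over different leaf sets comparable; [inord] is faithful when
    [d l <= N.+1]. *)
Definition physical (A : {set t}) (j : multi_index d A) (l : t) : 'I_N.+1 :=
  if insub l is Some x then inord (j x) else ord0.

Definition key (v : t) (b : colouring) (e : t -> 'I_N.+1) : parameter :=
  (v, b v, [ffun u => if u \in children v then b u else ord0],
   if v \in leaves t then e v else ord0).

(** All edges share one alphabet; the indicator restricts it to the rank and forces colour 0 above
    the root. *)
Definition vertex_factor (P : parameter -> C) (b : colouring) (e : t -> 'I_N.+1) v : C :=
  (b v < rank_at r v)%:R * P (key v b e).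

Definition network (P : parameter -> C) : tensor R d (leaves_below root) :=
  [ffun j => \sum_(b : colouring) \prod_v vertex_factor P b (physical j) v].

Lemma physical_inj (j j' : entry) :
  {in leaves t, physical j =1 physical j'} -> j = j'.
Proof.
move=> e; apply/ffunP => x; have lx := entry_leaf x.
have := e _ lx; rewrite /physical valK => /(congr1 val).
have dx : (d (val x) <= N.+1)%N by apply: d_le.
rewrite /= !inordK; first exact: val_inj.
  exact: leq_trans (ltn_ord _) dx.
exact: leq_trans (ltn_ord _) dx.
Qed.

Lemma physical_leaf_act n (J : {ffun 'I_n -> entry}) G i l : l \in leaves t ->
  physical (leaf_act J G i) l = physical (J (G l i)) l.
Proof.
move=> hl; rewrite /physical.
case: insubP => [x _ <-|]; first by rewrite leaf_actE.
by rewrite leaves_below_root hl.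
Qed.

Variable n : nat.
Local Notation word := {ffun 'I_n -> 'I_N.+1}.
Local Notation perms := {ffun t -> 'S_n}.

(* The left-hand side is, up to a positive factor, the coefficient in
   [sum_J F J * prod_i network P (J i)] of the monomial whose variables at [v]
   read off [(X v).2] above, [(X u).1] at the children [u], and [J0] at leaves. *)
Lemma compatible_sum_eq0 (F : {ffun 'I_n -> entry} -> C) :
    (forall P, \sum_J F J * \prod_i network P (J i) = 0) ->
  forall (X : t -> word * word) (J0 : {ffun 'I_n -> entry}),
    (forall v, colours_below (rank_at r v) (X v).2) ->
  \sum_(G : perms | compatible X G) F (leaf_act J0 G) = 0.
Proof.
move=> F0 X J0 vX.
pose I := ({ffun 'I_n -> entry} * {ffun 'I_n -> colouring})%type.
pose W (q : I) v i := key v (q.2 i) (physical (q.1 i)).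
pose target v i : parameter := (v, (X v).2 i,
  [ffun u => if u \in children v then (X u).1 i else ord0],
  if v \in leaves t then physical (J0 i) v else ord0).
pose c (q : I) : C := F q.1 * \prod_i \prod_v (q.2 i v < rank_at r v)%:R.
pose tag (a : parameter) : t := a.1.1.1.
(* The coefficient of the monomial with variables [target], after expanding all [n] networks over
   their colourings. *)
have coefs0 : \sum_(q : I | [forall a, letter_count (W q) a == letter_count target a]) c q = 0.
  apply: (coef_sum_eq0 (l := index_enum I)) => P; rewrite -[RHS](F0 P).
  rewrite -(pair_bigA _ (fun J B => c (J, B) * \prod_a P a ^+ letter_count (W (J, B)) a)) /=.
  apply: eq_bigr => J _.
  rewrite [in RHS](eq_bigr (fun i => \sum_(b : colouring)
     \prod_v vertex_factor P b (physical (J i)) v)) => [|i _]; last by rewrite ffunE.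
  rewrite bigA_distr_bigA mulr_sumr; apply: eq_bigr => B _.
  rewrite /c -mulrA -prod_letters; congr (_ * _).
  rewrite -(pair_bigA _ (fun v i => P (W (J, B) v i))) /= [X in _ * X = _]exchange_big -big_split /=.
  by apply: eq_bigr => i _; rewrite -big_split.
(* Given [G], at most one [q] is possible: [(X v).2] fixes the colours and [J0] the leaf indices.
   The child slots of [target] then demand compatibility. *)
have solve (G : perms) :
    \sum_(q : I) c q * (transports (W q) target G)%:R =
    (compatible X G)%:R * F (leaf_act J0 G).
  pose B0 : {ffun 'I_n -> colouring} := [ffun i => [ffun v => (X v).2 (G v i)]].
  have uniq_sol q : transports (W q) target G -> q = (leaf_act J0 G, B0) /\ compatible X G.
    case: q => J B /transportsP e.
    have eB i v : B i v = (X v).2 (G v i) by have := e v i => -[].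
    split.
      congr (_, _); last by apply/ffunP => i; apply/ffunP => v; rewrite !ffunE eB.
      apply/ffunP => i; apply: physical_inj => l hl; rewrite physical_leaf_act //.
      by have := e l i => -[_ _]; rewrite /= hl.
    apply/forallP => v; apply/implyP => nr; apply/forallP => i.
    have := congr1 (fun a : parameter => a.1.2 v) (e (parent v) i).
    rewrite /= !ffunE (_ : v \in children (parent v)); last by apply/childrenP.
    by move=> <-; rewrite eB.
  have [cG|ncG] := boolP (compatible X G); last first.
    rewrite mul0r big1 // => q _; case: (boolP (transports (W q) target G)) => [/uniq_sol[_ cG]|_].
      by rewrite cG in ncG.
    by rewrite mulr0.
  rewrite mul1r (bigD1 (leaf_act J0 G, B0)) //= big1 => [|q nq]; last first.
    by case: (boolP (transports _ _ _)) nq => [/uniq_sol[-> _]|_ _]; rewrite ?eqxx ?mulr0.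
  rewrite addr0 /c /= big1 => [|i _]; last first.
    by rewrite big1 // => v _; rewrite !ffunE (forallP (vX v)).
  rewrite mulr1 (_ : transports _ _ _) ?mulr1 //.
  apply/transportsP => v i; congr (_, _, _, _).
  - by rewrite /= !ffunE.
  - apply/ffunP => u; rewrite !ffunE; case: ifP => // /childrenP[nr <-].
    by move/forallP/(_ u): cG; rewrite nr => /forallP/(_ i)/eqP.
  - by case: ifP => // hv; rewrite physical_leaf_act.
rewrite big_mkcond /= (eq_bigr (fun G : perms => \sum_(q : I) c q *
  (transports (W q) target G)%:R)) => [|G _]; last first.
  by rewrite solve; case: compatible; rewrite ?mul1r ?mul0r.
rewrite exchange_big /=.
(* Each [q] in the coefficient is counted as often as [target] has stabilizing families, so the
   double sum is a multiple of the coefficient. *)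
under eq_bigr => q _.
  rewrite -mulr_sumr -natr_sum (sum_transports (tag := tag)) // natrM mulrA.
  over.
rewrite -mulr_suml -[X in X * _ = _](_ : 0 = _) ?mul0r //.
rewrite -[LHS]coefs0 big_mkcond; apply: eq_bigr => q _.
by case: ifP; rewrite ?mulr1 ?mulr0.
Qed.

End Parametrization.

(** * Networks lie on the variety *)

Section NetworkInTTN.
Variables (R : realType) (t : rooted_tree) (d r : t -> nat) (N : nat).
Hypothesis rank_le : forall v, (rank_at r v <= N.+1)%N.
Local Notation C := R[i].
Local Notation root := (root_vertex t).
Local Notation colouring := {ffun t -> 'I_N.+1}.
Variable P : parameter t N -> C.
Implicit Types (v u w : t) (a : 'I_N.+1) (b c : colouring) (e : t -> 'I_N.+1).

Local Notation factor := (vertex_factor r P).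

Lemma vertex_factor_local b b' e e' w :
    (forall u, below u w -> b u = b' u) -> (w \in leaves t -> e w = e' w) ->
  factor b e w = factor b' e' w.
Proof.
move=> bb ee; rewrite /vertex_factor /key bb ?below_refl //.
have -> : [ffun u => if u \in children w then b u else ord0] =
    [ffun u => if u \in children w then b' u else ord0] :> colouring.
  apply/ffunP => u; rewrite !ffunE; case: ifP => // uw; apply: bb.
  exact: below_child uw (below_refl u).
by case: ifP => // lw; rewrite ee.
Qed.

(** A normalization outside the subtree, so that each colouring of the subtree is summed once. *)
Definition supported v b : bool := [forall w, ~~ below w v ==> (b w == ord0)].

(** The contraction of the subtree at [v], with colour [a] on the edge above it. *)
Definition branch e v a : C :=
  \sum_(b : colouring | supported v b && (b v == a)) \prod_(w | below w v) factor b e w.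

Lemma branch_local e e' v a :
  {in leaves t, forall l, below l v -> e l = e' l} -> branch e v a = branch e' v a.
Proof.
move=> ee; apply: eq_bigr => b _; apply: eq_bigr => w wv.
by apply: vertex_factor_local => // lw; apply: ee.
Qed.

Lemma branch_eq0 e v a : (rank_at r v <= a)%N -> branch e v a = 0.
Proof.
move=> ra; apply: big1 => b /andP[_ /eqP bv].
by rewrite (bigD1 v) ?below_refl //= /vertex_factor bv ltnNge ra !mul0r.
Qed.

Definition top_child v w : t := odflt v [pick u in children v | below w u].

Lemma top_childE v w u : u \in children v -> below w u -> top_child v w = u.
Proof.
move=> uv wu; rewrite /top_child; case: pickP => [u' /andP[uv' wu']|/(_ u)] /=.
  exact: below_child_inj uv' uv wu' wu.
by rewrite uv wu.
Qed.

Lemma top_childP v w : below w v -> w != v ->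
  (top_child v w \in children v) && below w (top_child v w).
Proof. by move=> wv nw; have [u uv wu] := below_split wv nw; rewrite (top_childE uv wu) uv. Qed.

Lemma prod_below (F : t -> C) v :
  \prod_(w | below w v) F w =
  F v * \prod_(u in children v) \prod_(w | below w u) F w.
Proof.
rewrite (bigD1 v) ?below_refl //=; congr (_ * _).
rewrite (partition_big (top_child v) (mem (children v))) /=; last first.
  by move=> w /andP[wv nw]; have /andP[] := top_childP wv nw.
apply: eq_bigr => u uv; apply: eq_bigl => w.
apply/andP/idP => [[/andP[wv nw] /eqP <-]|wu].
  by have /andP[] := top_childP wv nw.
by rewrite (top_childE uv wu) (below_child uv wu) (below_child_neq uv wu).
Qed.

Definition child_colourings v : {set colouring} :=
  [set c : colouring | [forall u, (u \notin children v) ==> (c u == ord0)]].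

Lemma branch_split e v a : v \notin leaves t ->
  branch e v a =
  \sum_(c in child_colourings v)
    ((a < rank_at r v)%:R * P (v, a, c, ord0)) * \prod_(u in children v) branch e u (c u).
Proof.
move=> nlv; pose z : colouring := [ffun => ord0].
pose Q c u b : bool := supported u b && (b u == c u).
under [RHS]eq_bigr do rewrite (big_distr_big_dep z) mulr_sumr.
rewrite pair_big_dep /=.
pose cut b (u : t) : colouring := [ffun w => if below w u then b w else ord0].
(* [h] cuts a colouring into the colours of the children and the parts below them; [h'] glues these
   back with [a] at [v]. *)
pose h b : colouring * {ffun t -> colouring} :=
  ([ffun u => if u \in children v then b u else ord0],
   [ffun u => if u \in children v then cut b u else z]).
pose h' (q : colouring * {ffun t -> colouring}) : colouring :=
  [ffun w => if w == v then a else if below w v then q.2 (top_child v w) w else ord0].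
rewrite (reindex_onto h h') /=; last first.
  move=> [c g] /=; rewrite inE => /andP[/forallP cs /familyP gs].
  have gP u : u \in children v -> supported u (g u) /\ g u u = c u.
    by move=> uv; have := gs u; rewrite uv => /andP[? /eqP].
  have hE u w : u \in children v -> below w u -> h' (c, g) w = g u w.
    move=> uv wu; rewrite ffunE (negbTE (below_child_neq uv wu)) (below_child uv wu).
    by rewrite (top_childE uv wu).
  congr (_, _); apply/ffunP => u; rewrite ffunE.
    case: ifP => uv; first by rewrite (hE u) ?below_refl //; case: (gP u uv).
    by have := cs u; rewrite uv => /eqP.
  case: ifP => uv; last by have := gs u; rewrite uv => /eqP.
  apply/ffunP => w; rewrite ffunE; case: ifP => wu; first exact: hE.
  by have [/forallP/(_ w)] := gP u uv; rewrite wu => /eqP.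
have cutE b u w : u \in children v -> below w u -> factor b e w = factor (cut b u) e w.
  move=> uv wu; apply: vertex_factor_local => // x xw.
  by rewrite ffunE (below_trans xw wu).
apply: eq_big => [b|b /andP[sb /eqP bv]].
  apply/andP/andP => [[/forallP sb /eqP bv]|[_ /eqP/ffunP hb]].
    split.
      apply/andP; split.
        by rewrite inE; apply/forallP => u; apply/implyP => /negbTE uv; rewrite ffunE uv.
      apply/familyP => u; rewrite ffunE; case: ifP => uv; last by rewrite inE eqxx.
      apply/andP; split; last by rewrite !ffunE below_refl uv.
      by apply/forallP => w; apply/implyP => /negbTE wu; rewrite ffunE wu.
    apply/eqP/ffunP => w; rewrite ffunE; case: eqP => [-> //|/eqP nw].
    case: ifP => wv; last by have := sb w; rewrite wv => /eqP.
    have /andP[tv wt] := top_childP wv nw.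
    by rewrite /= ffunE tv ffunE wt.
  split; last by rewrite -hb ffunE eqxx.
  apply/forallP => w; apply/implyP => nwv; rewrite -hb ffunE (negbTE nwv).
  by have [wv|//] := eqVneq w v; rewrite wv below_refl in nwv.
rewrite prod_below; congr (_ * _).
  by rewrite /vertex_factor /key bv (negbTE nlv).
apply: eq_bigr => u uv; apply: eq_bigr => w wu.
by rewrite ffunE uv -cutE.
Qed.

Lemma network_branch j : network d r P j = branch (physical N j) root ord0.
Proof.
rewrite ffunE (bigID (fun b : colouring => b root == ord0)) /=.
rewrite [X in _ + X]big1 ?addr0 => [|b b0]; last first.
  rewrite (bigD1 root) //= /vertex_factor /rank_at eqxx ltnS leqn0.
  by rewrite (_ : (b root == 0%N :> nat) = false) ?mul0r //; apply: negbTE.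
apply: eq_big => [b|b _].
  rewrite (_ : supported root b) //; apply/forallP => w.
  by rewrite below_root.
by apply: eq_bigl => w; rewrite below_root.
Qed.

Definition branch_tensor v a : tensor R d (leaves_below v) :=
  [ffun j => branch (physical N j) v a].

Definition branch_space v : {vspace tensor R d (leaves_below v)} :=
  <<[tuple branch_tensor v (inord k) | k < rank_at r v]>>%VS.

Lemma branch_tensor_mem v a : branch_tensor v a \in branch_space v.
Proof.
have [lt|le] := ltnP a (rank_at r v).
  apply: memv_span; apply/mapP; exists (Ordinal lt); rewrite ?mem_enum //.
  by congr branch_tensor; apply: val_inj; rewrite /= inordK.
rewrite (_ : branch_tensor v a = 0) ?mem0v //.
by apply/ffunP => j; rewrite !ffunE branch_eq0.
Qed.

Lemma physical_restrict u v (uv : u \in children v) (j : multi_index d (leaves_below v)) :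
  {in leaves t, forall l, below l u ->
     physical N (restrict_index (leaves_below_child uv) j) l = physical N j l}.
Proof.
move=> l hl lu; rewrite /physical.
case: insubP => [x xl xE|]; last by rewrite leaves_belowE // lu.
case: insubP => [y yl yE|]; last by rewrite leaves_belowE // (below_child uv lu).
rewrite ffunE; move: (fintype.subsetP _ _ _) => h.
by move: h; rewrite xE -yE => h; case: y yE h {yl} => y hy yE h; rewrite (bool_irrelevance h hy).
Qed.

(** [branch_split] expands each spanning tensor into pure tensors of branches at the children. *)
Lemma branch_space_tensor_prod v x : v \notin leaves t -> x \in branch_space v ->
  tensor_prod branch_space x.
Proof.
move=> nlv /coord_span xE.
pose X := [tuple branch_tensor v (inord k) | k < rank_at r v].
pose I := ('I_(rank_at r v) * {c | c \in child_colourings v})%type.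
pose co (i : I) : C := coord X i.1 x * P (v, inord i.1, val i.2, ord0).
pose f (i : I) (u : {u | u \in children v}) := branch_tensor (val u) (val i.2 (val u)).
exists #|{: I}|, (fun k => co (enum_val k)), (fun k => f (enum_val k)); split.
  by move=> k u; apply: branch_tensor_mem.
rewrite -/X in xE.
have XE (k : 'I_(rank_at r v)) : X`_k = branch_tensor v (inord k).
  by rewrite -tnth_nth tnth_mktuple.
rewrite [LHS]xE; under eq_bigr do rewrite XE.
transitivity (\sum_(i : I) co i *: pure_tensor (f i)).
  rewrite -(pair_bigA _ (fun (k : 'I_(rank_at r v)) (c : {c | c \in child_colourings v}) =>
    co (k, c) *: pure_tensor (f (k, c)))) /=.
  apply: eq_bigr => k _.
  rewrite (eq_bigr (fun c : {c | c \in child_colourings v} => coord X k x *: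
    (P (v, inord k, val c, ord0) *: pure_tensor (f (k, c))))) => [|c _]; last first.
    by rewrite scalerA.
  rewrite -scaler_sumr; congr (_ *: _); apply/ffunP => j.
  rewrite sum_ffunE ffunE branch_split // big_sub /=.
  apply: eq_bigr => c _; rewrite ffunE [pure_tensor _ _]ffunE.
  have kr : (k < N.+1)%N := leq_trans (ltn_ord k) (rank_le v).
  rewrite inordK // ltn_ord mul1r big_sub; congr (_ * _).
  apply: eq_bigr => u _; rewrite ffunE; apply: branch_local => l hl lu.
  by rewrite physical_restrict.
by rewrite (reindex (enum_val : 'I_#|{: I}| -> I)) //=; exists enum_rank => i _; rewrite ?enum_valK ?enum_rankK.
Qed.

Lemma network_in_TTN (l : proj_space (tensor R d (leaves_below root))) :
  represents (network d r P) l -> TTN R d r l.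
Proof.
move=> rep; exists branch_space; split.
- by move=> v; rewrite (leq_trans (dim_span _)) // size_tuple.
- by move=> v nlv x; apply: branch_space_tensor_prod.
exists (network d r P); split=> //.
rewrite (_ : network d r P = branch_tensor root ord0) ?branch_tensor_mem //.
by apply/ffunP => j; rewrite network_branch ffunE.
Qed.

End NetworkInTTN.

(** * The minors vanish on the variety *)

Section FlatteningRank.
Variables (R : realType) (t : rooted_tree) (d r : t -> nat).
Local Notation C := R[i].
Local Notation root := (root_vertex t).
Local Notation index v := (multi_index d (leaves_below v)).
Local Notation W := (tensor R d (leaves_below root)).

(** Unlike [merge_index], this takes a full index [k], which makes it commute with restriction to a
    child. *)
Definition overwrite (v w : t) (j : index v) (k : index w) : index w :=
  finfun (fun x : {x | x \in leaves_below w} =>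
    match boolP (val x \in leaves_below v) return 'I_(d (val x)) with
    | AltTrue xv => j (exist _ (val x) xv)
    | AltFalse _ => k x
    end).

Lemma overwrite_id v (j k : index v) : overwrite j k = j.
Proof.
apply/ffunP => x; rewrite ffunE; case: {-}_ / boolP => [h|]; last by rewrite (valP x).
by case: x h => l hl h; rewrite (bool_irrelevance h hl).
Qed.

Lemma restrict_overwrite v u w (uw : u \in children w) (j : index v) (k : index w) :
  restrict_index (leaves_below_child uw) (overwrite j k) =
  overwrite j (restrict_index (leaves_below_child uw) k).
Proof. by apply/ffunP => x; rewrite !ffunE; case: {-}_ / boolP => h //=; rewrite ffunE. Qed.

Lemma restrict_overwrite_sibling v u u' w (uw : u \in children w)
    (uw' : u' \in children w) (j : index v) (k : index w) :
  below v u' -> u != u' ->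
  restrict_index (leaves_below_child uw) (overwrite j k) =
  restrict_index (leaves_below_child uw) k.
Proof.
move=> vu' ne; apply/ffunP => x; rewrite !ffunE; case: {-}_ / boolP => h //=.
case/eqP: ne; apply: (below_child_inj uw uw' (w := val x)).
  by have := valP x; rewrite inE => /andP[].
by apply: below_trans vu'; move: h; rewrite inE => /andP[].
Qed.

Lemma merge_overwrite v (j j' : index v)
    (k : multi_index d (leaves_below root :\: leaves_below v)) :
  merge_index j k = overwrite j (merge_index j' k).
Proof.
apply/ffunP => x; rewrite [RHS]ffunE ffunE; case: {-}_ / boolP => [//|h].
rewrite ffunE; case: {-}_ / boolP => [h'|h']; first by case/negP: (h).
by rewrite (bool_irrelevance h h').
Qed.

Variable U : forall v : t, {vspace tensor R d (leaves_below v)}.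
Hypothesis U_prod : forall v, v \notin leaves t ->
  forall x, x \in U v -> tensor_prod U x.

Definition slice (v w : t) (x : tensor R d (leaves_below w)) (k : index w) :
    tensor R d (leaves_below v) :=
  [ffun j => x (overwrite j k)].

(** Descends one edge at a time: slicing a pure tensor slices its factor at the child towards [v]
    and turns the other factors into scalars. *)
Lemma slice_mem v w (x : tensor R d (leaves_below w)) (k : index w) :
  below v w -> x \in U w -> slice v x k \in U v.
Proof.
have [m] : exists m, (depth v - depth w)%N = m by eexists.
elim: m w x k => [|m IH] w x k dm vw xU; have [e|ne] := eqVneq v w.
- subst w; rewrite (_ : slice _ _ _ = x) //.
  by apply/ffunP => j; rewrite ffunE overwrite_id.
- have [u uw vu] := below_split vw ne.
  have := below_depth vu; rewrite (depth_child uw).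
  by move/eqP: dm; rewrite subn_eq0 leqNgt => /negbTE ->.
- by subst w; rewrite subnn in dm.
have [u uw vu] := below_split vw ne.
have nlw : w \notin leaves t.
  by rewrite inE; apply/eqP => w0; rewrite w0 inE in uw.
have [n [c [f [fU xE]]]] := U_prod nlw xU.
pose u0 : {u | u \in children w} := exist _ u uw.
have dm' : (depth v - depth u)%N = m by rewrite (depth_child uw) subnS dm.
rewrite (_ : slice v x k = \sum_(i < n)
    (c i * \prod_(u' | u' != u0) f i u' (restrict_index (leaves_below_child (valP u')) k)) *:
      slice v (f i u0) (restrict_index (leaves_below_child (valP u0)) k)).
  by apply: memv_suml => i _; apply: memvZ; apply: IH => //; apply: fU.
apply/ffunP => j; rewrite xE sum_ffunE !ffunE sum_ffunE; apply: eq_bigr => i _.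
rewrite !ffunE -scalerA; congr (_ *: _); rewrite (bigD1 u0) //= mulrC; congr (_ * _).
  apply: eq_bigr => u' nu; rewrite (restrict_overwrite_sibling _ (valP u0)) //.
by rewrite restrict_overwrite.
Qed.

Lemma det_factor_eq0 (m n : nat) (A : 'M[C]_(m, n)) (B : 'M[C]_(n, m)) :
  (n < m)%N -> \det (A *m B) = 0.
Proof.
move=> lt; apply/eqP/negPn/negP => nz.
have : A *m B \in unitmx by rewrite unitmxE unitfE.
rewrite -row_free_unit /row_free => /eqP rk.
by have := mulmx_max_rank A B; rewrite rk leqNgt lt.
Qed.

(** The columns of the evaluated flattening are slices of [x], hence lie in [U v], and the submatrix
    factors through dimension at most [r v]. *)
Lemma minor_vanish (v : t) (x : W) p : (\dim (U v) <= r v)%N -> x \in U root ->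
  minors (r v).+1 (flattening R d v) p -> poly_at p x = 0.
Proof.
move=> dimU xU [f [g [_ _ ->]]].
rewrite /poly_at -det_map_mx.
(* [f ord0] is a filler: slicing overwrites the part below [v]. *)
pose k b : index root := merge_index (enum_val (f ord0)) (enum_val (g b)).
pose s b := slice v x (k b).
have sU b : s b \in U v by apply: slice_mem xU; apply: below_root.
rewrite (_ : map_mx _ _ =
  (\matrix_(a < (r v).+1, i < \dim (U v)) ((vbasis (U v))`_i (enum_val (f a)) : C)) *m
  (\matrix_(i < \dim (U v), b < (r v).+1) coord (vbasis (U v)) i (s b))) ?det_factor_eq0 //.
apply/matrixP => a b; rewrite !mxE /psi /= mevalXU enum_rankK.
rewrite (merge_overwrite _ (enum_val (f ord0))).
transitivity (s b (enum_val (f a))); first by rewrite ffunE.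
rewrite [in LHS](coord_vbasis (sU b)) sum_ffunE; apply: eq_bigr => i _.
by rewrite ffunE !mxE mulrC.
Qed.

End FlatteningRank.

Lemma represents_scale (F : fieldType) (V : vectType F) (l : proj_space V) (x y : V) :
  represents x l -> represents y l -> exists c, y = c *: x.
Proof.
move=> [x0 xl] [_ yl]; apply/vlineP; rewrite (_ : <[x]>%VS = val l) //.
apply/eqP; rewrite eqEdim; apply/andP; split; first by rewrite -memvE.
by rewrite dim_vline x0 (eqP (valP l)).
Qed.

Lemma TTN_minor_vanish (R : realType) (t : rooted_tree) (d r : t -> nat) l x v p :
  TTN R d r l -> represents x l -> v != root_vertex t ->
  minors (r v).+1 (flattening R d v) p -> poly_at p x = 0.
Proof.
move=> [U [dimU Uprod [y [yl yU]]]] xl nv; apply: (minor_vanish Uprod).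
  by have := dimU v; rewrite /rank_at (negbTE nv).
by have [c ->] := represents_scale yl xl; apply: memvZ.
Qed.

(** * The vanishing ideal *)

Section Evaluation.
Variables (R : realType) (t : rooted_tree) (d : t -> nat).
Local Notation C := R[i].
Local Notation entry := (multi_index d (leaves_below (root_vertex t))).
Local Notation W := (tensor R d (leaves_below (root_vertex t))).
Local Notation Cpsi := {mpoly C[#|{: entry}|]}.
Implicit Types (p q : Cpsi) (x : W).

Lemma poly_atM p q x : poly_at (p * q) x = poly_at p x * poly_at q x.
Proof. exact: mevalM. Qed.

Lemma poly_at_sum (I : Type) (l : seq I) (P : pred I) (F : I -> Cpsi) x :
  poly_at (\sum_(i <- l | P i) F i) x = \sum_(i <- l | P i) poly_at (F i) x.
Proof. exact: raddf_sum. Qed.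

Lemma poly_at_mon n (F : {ffun 'I_n -> entry} -> C) x :
  poly_at (\sum_J F J *: mon R J) x = \sum_J F J * \prod_i x (J i).
Proof.
rewrite poly_at_sum; apply: eq_bigr => J _.
rewrite /poly_at mevalZ /mon rmorph_prod; congr (_ * _); apply: eq_bigr => i _.
by rewrite /psi /= mevalXU enum_rankK.
Qed.

Lemma poly_at_scale n q (a : C) x : q \is n.-homog ->
  poly_at q (a *: x) = a ^+ n * poly_at q x.
Proof.
move=> /dhomogP hq; rewrite /poly_at !mevalE mulr_sumr big_seq [RHS]big_seq.
apply: eq_bigr => m /hq mn; rewrite mulrCA; congr (_ * _).
have -> : n = (\sum_i m i)%N by rewrite -mdegE -mn.
rewrite -prodrXr -big_split; apply: eq_bigr => i _.
by rewrite ffunE exprMn.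
Qed.

Lemma monomial_word (k : nat) (m : 'X_{1..k}) : exists s : seq 'I_k,
  size s = mdeg m /\ 'X_[m] = \prod_(i <- s) 'X_i :> {mpoly C[k]}.
Proof.
exists (flatten [seq nseq (m i) i | i <- enum 'I_k]); split.
  rewrite size_flatten /shape -map_comp mdegE sumnE big_map big_enum.
  by apply: eq_bigr => i _ /=; rewrite size_nseq.
rewrite big_flatten big_map big_enum mpolyXE_id; apply: eq_bigr => i _.
by rewrite big_nseq iter_mulr_1.
Qed.

Lemma homog_mon n q : q \is n.-homog ->
  exists F : {ffun 'I_n -> entry} -> C, q = \sum_J F J *: mon R J.
Proof.
move=> /dhomogP hq; rewrite [q]mpolyE big_seq.
elim/big_rec: _ => [|m p mq [F ->]].
  by exists (fun _ => 0); rewrite big1 // => J _; rewrite scale0r.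
have [s [sz mE]] := monomial_word m.
have {}sz : size s == n by rewrite sz; apply/eqP/hq.
pose J0 : {ffun 'I_n -> entry} := [ffun i => enum_val (tnth (Tuple sz) i)].
have -> : 'X_[m] = mon R J0.
  rewrite mE -[s]/(tval (Tuple sz)) big_tuple; apply: eq_bigr => i _.
  by rewrite /psi ffunE enum_valK.
exists (fun J => (if J == J0 then q@_m else 0) + F J).
under [RHS]eq_bigr do rewrite scalerDl.
rewrite big_split; congr (_ + _); rewrite (bigD1 J0) //= eqxx big1 ?addr0 // => J.
by move/negbTE ->; rewrite scale0r.
Qed.

End Evaluation.

Lemma mpoly_eq0_of_meval (C : numDomainType) k (p : {mpoly C[k]}) :
  (forall P, p.@[P] = 0) -> p = 0.
Proof.
move=> p0; apply/mpolyP => m; rewrite mcoeff0.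
have := @coef_sum_eq0 C _ _ (msupp p) (fun m => p@_m) (fun m i => m i).
have vanish P : \sum_(m' <- msupp p) p@_m' * \prod_a P a ^+ m' a = 0.
  by rewrite -mevalE.
move/(_ vanish m) => e; have [pm|/memN_msupp_eq0 //] := boolP (m \in msupp p).
move: e; rewrite -big_filter (_ : filter _ _ = [:: m]) ?big_seq1 //.
rewrite (eq_filter (a2 := pred1 m)) ?filter_pred1_uniq ?msupp_uniq // => m' /=.
apply/forallP/eqP => [e|-> i //]; apply/mnmP => i; exact/eqP.
Qed.

Section VanishingIdeal.
Variables (R : realType) (t : rooted_tree) (d r : t -> nat).
Hypothesis d_gt0 : forall l : t, l \in leaves t -> (0 < d l)%N.
Hypothesis r_seq : rank_sequence r.
Local Notation C := R[i].
Local Notation root := (root_vertex t).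
Local Notation entry := (multi_index d (leaves_below root)).
Local Notation W := (tensor R d (leaves_below root)).
Local Notation Cpsi := {mpoly C[#|{: entry}|]}.
Local Notation minors_ideal := (ideal_sum (fun v : t => v != root)
  (fun v : t => ideal_gen (minors (r v).+1 (flattening R d v)))).

Definition colour_bound : nat := \max_v maxn (rank_at r v) (d v).
Local Notation N := colour_bound.

Lemma rank_le_bound v : (rank_at r v <= N.+1)%N.
Proof.
apply/leqW; apply: leq_trans (leq_bigmax v); exact: leq_maxl.
Qed.

Lemma dim_le_bound l : l \in leaves t -> (d l <= N.+1)%N.
Proof.
move=> _; apply/leqW; apply: leq_trans (leq_bigmax l); exact: leq_maxr.
Qed.

Local Notation net := (@network R t d r N).
Implicit Types (p q : Cpsi) (P : parameter t N -> C).

Lemma entry_inhabited : inhabited entry.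
Proof.
by exists; exact: (finfun (fun x : {l | l \in leaves_below root} => Ordinal (d_gt0 (entry_leaf x)))).
Qed.

Lemma rank_gt0 v : (0 < rank_at r v)%N.
Proof. by rewrite /rank_at; case: eqP => // /eqP; apply: r_seq. Qed.

(** Each entry counts the colourings that respect the ranks, among them the zero colouring. *)
Lemma network_neq0 : net (fun _ => 1) != 0.
Proof.
have [j] := entry_inhabited; apply/eqP => /ffunP/(_ j)/eqP.
rewrite !ffunE psumr_eq0 => [|b _]; last first.
  by apply: prodr_ge0 => v _; rewrite /vertex_factor mulr1 ler0n.
move/allP/(_ [ffun => ord0]); rewrite mem_index_enum => /(_ isT) /=.
by rewrite big1 ?oner_eq0 // => v _; rewrite /vertex_factor ffunE rank_gt0 mulr1.
Qed.

(** A zero network represents no point; it is treated as 0 times a non-zero network, which also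
    covers degree 0. *)
Lemma vanishing_network_homog n q P : q \is n.-homog ->
  (forall l, TTN R d r l -> forall x, represents x l -> poly_at q x = 0) ->
  poly_at q (net P) = 0.
Proof.
move=> hq q0.
have nz P' : net P' != 0 -> poly_at q (net P') = 0.
  move=> nzP; have dl : \dim <[net P']>%VS == 1%N by rewrite dim_vline nzP.
  have rep : represents (net P') (exist _ <[net P']>%VS dl) by split; rewrite ?memv_line.
  by apply: (q0 _ _ _ rep); apply: network_in_TTN rep; apply: rank_le_bound.
have [e|/nz //] := eqVneq (net P) 0.
by rewrite e -(scale0r (net (fun _ => 1))) (poly_at_scale _ _ hq) nz ?mulr0 // network_neq0.
Qed.

Lemma vanishing_network p P : vanishing_ideal (TTN R d r) p -> poly_at p (net P) = 0.
Proof.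
case=> n [a [s [sP ->]]]; rewrite poly_at_sum big1 // => i _.
by have [[k hk] s0] := sP i; rewrite poly_atM (vanishing_network_homog _ hk) ?mulr0.
Qed.

Lemma minor_homog k m n (M : 'M[Cpsi]_(m, n)) p :
  (forall i j, M i j \is 1.-homog) -> minors k M p -> p \is k.-homog.
Proof.
move=> hM [f [g [_ _ ->]]]; apply: rpred_sum => s _.
have prod_homog l (F : 'I_l -> Cpsi) : (forall i, F i \is 1.-homog) ->
    \prod_i F i \is l.-homog.
  elim: l F => [|l IH] F hF; first by rewrite big_ord0 dhomog1.
  by rewrite big_ord_recl; apply: (dhomogM (d := 1) (e := l)); [|apply: IH].
have : \prod_i mxsub f g M i (s i) \is k.-homog.
  by apply: prod_homog => i; rewrite mxE.
by rewrite mulr_sign; case: odd_perm; rewrite ?dhomogN.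
Qed.

Lemma minors_ideal_vanishing p : minors_ideal p -> vanishing_ideal (TTN R d r) p.
Proof.
case=> q [qI ->]; rewrite /vanishing_ideal; apply: ideal_gen_sum => v nv.
have [n [a [s [sM ->]]]] := qI v nv; apply: ideal_gen_sum => i _.
apply: ideal_genMl; apply: ideal_gen_mem; split.
  exists (r v).+1; apply: minor_homog (sM i) => a' b'; rewrite mxE dhomogX.
  exact/eqP/mdeg1.
by move=> l lT x xl; apply: TTN_minor_vanish lT xl nv (sM i).
Qed.

Lemma network_scale P (a : C) :
  net (fun k => if k.1.1.1 == root then a * P k else P k) = a *: net P.
Proof.
apply/ffunP => j; rewrite !ffunE.
transitivity (a * \sum_(b : {ffun t -> 'I_N.+1})
  \prod_v vertex_factor r P b (physical N j) v); last by [].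
rewrite mulr_sumr; apply: eq_bigr => b _.
rewrite (bigD1 root) //= [in RHS](bigD1 root) //= mulrA; congr (_ * _).
  by rewrite /vertex_factor /= eqxx mulrCA.
by apply: eq_bigr => v /negbTE nv; rewrite /vertex_factor /= nv.
Qed.

Lemma network_vanishing_minors p :
  (forall P, poly_at p (net P) = 0) -> minors_ideal p.
Proof.
move=> p0; rewrite (pihomog_partitionE (mf := mdeg) (leqnn (msize p))).
apply: ideal_sum_sum => n _; set q := pihomog _ _ _.
have q0 P : poly_at q (net P) = 0.
  (* Scaling the root tensor by [z] turns the values of the homogeneous parts into the coefficients
     of a polynomial in [z]. *)
  pose f : {poly C} := \sum_(k < msize p) poly_at (pihomog mdeg k p) (net P) *: 'X^k.
  have f0 : f = 0.
    apply: poly_eq0_of_horner => z; rewrite horner_sum.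
    rewrite -[RHS](p0 (fun k => if k.1.1.1 == root then z * P k else P k)) network_scale.
    rewrite [in RHS](pihomog_partitionE (mf := mdeg) (leqnn (msize p))) poly_at_sum.
    apply: eq_bigr => k _.
    by rewrite hornerZ hornerXn (poly_at_scale _ _ (pihomogP _ _ _)) mulrC.
  have := coef0 C n; rewrite -f0 coef_sum (bigD1 n) //= coefZ coefXn eqxx mulr1.
  rewrite big1 ?addr0 // => k kn; rewrite coefZ coefXn.
  case: eqP => [/val_inj nk|_]; last by rewrite mulr0.
  by rewrite nk eqxx in kn.
have [F qE] := homog_mon (pihomogP mdeg n p : q \is n.-homog).
rewrite qE; apply: (straightened_mem rank_le_bound) => X J vX.
apply: (compatible_sum_eq0 (r := r) dim_le_bound) => [P|v]; last by have /andP[] := vX v.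
by rewrite -poly_at_mon -qE.
Qed.

Lemma vanishing_idealP p :
  vanishing_ideal (TTN R d r) p <-> forall P, poly_at p (net P) = 0.
Proof.
split=> [pV P|/network_vanishing_minors]; first exact: vanishing_network.
exact: minors_ideal_vanishing.
Qed.

(** The network with indeterminate parameters; composing with it is the pull-back. *)
Definition generic_network : #|{: entry}|.-tuple {mpoly C[#|{: parameter t N}|]} :=
  [tuple \sum_(b : {ffun t -> 'I_N.+1}) \prod_v
     ((b v < rank_at r v)%:R *: 'X_(enum_rank (key v b (physical N (enum_val j)))))
   | j < #|{: entry}|].

Lemma meval_generic_network p Q :
  (p \mPo generic_network).@[Q] = poly_at p (net (fun k => Q (enum_rank k))).
Proof.
rewrite comp_mpoly_meval /poly_at; apply: meval_eq => j.
rewrite tnth_mktuple rmorph_sum ffunE; apply: eq_bigr => b _.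
rewrite rmorph_prod; apply: eq_bigr => v _.
by rewrite /= mevalZ mevalXU.
Qed.

(** Composition with [generic_network] is a ring morphism into an integral domain, and its kernel is
    the vanishing ideal. *)
Lemma vanishing_ideal_prime : prime_ideal (vanishing_ideal (TTN R d r)).
Proof.
have vanish p : p \mPo generic_network = 0 -> vanishing_ideal (TTN R d r) p.
  move=> p0; apply/vanishing_idealP => P.
  have := meval_generic_network p (fun i => P (enum_val i)); rewrite p0 meval0 => /esym.
  by under [fun k => _]funext do rewrite enum_rankK.
split=> [V1|p q pq].
  have := vanishing_network (fun _ => 0) V1; rewrite /poly_at meval1 => /eqP.
  by rewrite oner_eq0.
have : (p \mPo generic_network) * (q \mPo generic_network) = 0.
  rewrite -rmorphM; apply: mpoly_eq0_of_meval => Q.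
  by rewrite meval_generic_network; apply: vanishing_network.
by move/eqP; rewrite mulf_eq0 => /orP[] /eqP /vanish; [left | right].
Qed.

End VanishingIdeal.

Theorem theorem1p1 (R : realType) (t : rooted_tree) (d r : t -> nat)
    (root_children : (2 <= #|children (root_vertex t)|)%N)
    (d_gt0 : forall l : t, l \in leaves t -> (0 < d l)%N)
    (r_seq : rank_sequence r)
    (r_adm : admissible d r) :
  prime_ideal (vanishing_ideal (TTN R d r)) /\
  vanishing_ideal (TTN R d r) =
    ideal_sum (fun v : t => v != root_vertex t)
      (fun v : t => ideal_gen (minors (r v).+1 (flattening R d v))).
Proof.
split; first exact: vanishing_ideal_prime.
apply/seteqP; split=> p; last exact: minors_ideal_vanishing.
by move=> pV; apply: network_vanishing_minors => P; apply: vanishing_network.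
Qed.
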